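(* Let $D\subset\mathbb{R}^2$ be a domain, let $c_0\neq0$ and $c_1>0$, $c_1\ne1$, be real constants with $c_0c_1/(c_1^4-1)>0$, and let $\mu_0\in\mathbb{R}$ satisfy $$\mu_0^2=\frac{c_0c_1}{c_1^4-1}.$$ Let $f^1,f^2:D\to\mathbb{R}$ be smooth functions of $z=(z_1,z_2)$ forming an anti-Cauchy--Riemann pair, i.e. $$\frac{\partial f^1}{\partial z_1}+\frac{\partial f^2}{\partial z_2}=0,\qquad \frac{\partial f^1}{\partial z_2}-\frac{\partial f^2}{\partial z_1}=0,$$ and suppose $1-|\nabla f^1|^2\neq0$ everywhere in $D$. Put $$\varphi(z,t)=\begin{pmatrix} c_1 & 0 \\ 0 & 1/c_1 \end{pmatrix}\begin{pmatrix} 1 & 0 & \cos(\mu_0t) & -\sin(\mu_0t) \\ 0 & 1 & \sin(\mu_0t) & \cos(\mu_0t) \end{pmatrix}\begin{pmatrix} z_1 \\ z_2 \\ f^1(z) \\ f^2(z) \end{pmatrix},\qquad \rho(z)=c_0z_2 .$$ Then $\det(d\varphi)=1-|\nabla f^1|^2$ and $(\varphi,\rho)$ is a solution to the two-dimensional Euler--Boussinesq equations for all $t\in\mathbb{R}$.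
   Context: The pressure-eliminated two-dimensional Euler--Boussinesq equations for a velocity field $u(x,t)\in\mathbb{R}^2$ and a rescaled density $\varrho(x,t)\in\mathbb{R}$ are $$\nabla\cdot u=0,\qquad \operatorname{curl}\big(u_t+(u\cdot\nabla)u+\varrho\, e_2\big)=0,\qquad \varrho_t+\langle u,\nabla\varrho\rangle=0,$$ where $e_2=(0,1)$ and $\operatorname{curl}F=\partial_1F_2-\partial_2F_1$. A pair $(\varphi,\rho)$, with $\varphi:D\times\mathbb{R}\to\mathbb{R}^2$ and $\rho:D\to\mathbb{R}$ smooth, is a solution to these equations if $\det(d\varphi)\ne0$ everywhere ($d\varphi$ is the Jacobian with respect to $z\in D$) and the fields $u,\varrho$ determined by $\partial_t\varphi(z,t)=u(\varphi(z,t),t)$ and $\rho(z)=\varrho(\varphi(z,t),t)$ satisfy them. If the maps $\varphi^t=\varphi(\cdot,t)$ are not injective, $u,\varrho$ are understood locally, on the images of neighbourhoods on which every $\varphi^t$ is injective. Equivalently: $\det(d\varphi)$ is nonzero and independent of time, and $$\sum_{i=1}^2\det(\nabla\varphi_i'',\nabla\varphi_i)+\det(\nabla\rho,\nabla\varphi_2)=0,$$ where primes are time derivatives and $\nabla$ is with respect to $z$. *)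

(* Defs.v *)
From HB Require Import structures.
From mathcomp Require Import all_boot all_order all_algebra.
From mathcomp Require Import all_classical all_reals all_analysis.
Set Implicit Arguments.
Unset Strict Implicit.
Unset Printing Implicit Defensive.
Import Order.TTheory GRing.Theory Num.Theory.
Import numFieldNormedType.Exports.
Local Open Scope classical_set_scope.
Local Open Scope ring_scope.

(* Points and vectors of the plane are columns 'cV[R]_2; indices
   are shifted: the first and second components are the entries 0 and 1.  *)

(* C^k on an open subset U of a finite-dimensional space V. Finiteness of the
   dimension makes C^(k-1) regularity of every directional derivative 'D_v g
   the same as C^(k-1) regularity of the differential; as U is meant to be
   open, only the values of g on U matter.                                *)
Fixpoint Ck_on (R : realType) (V W : normedModType R) (U : set V) (k : nat)
    (g : V -> W) : Prop :=
  match k with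
  | 0 => forall x, U x -> {for x, continuous g}
  | k'.+1 => (forall x, U x -> differentiable g x) /\
             (forall v : V, Ck_on U k' ('D_v g))
  end.

Definition smooth_on (R : realType) (V W : normedModType R) (U : set V)
    (g : V -> W) : Prop :=
  forall k, Ck_on U k g.

Section PlanarCalculus.
Variable R : realType.
Local Notation plane := 'cV[R]_2.

Definition basis_vec (i : 'I_2) : plane := delta_mx i 0.

Definition mx22 (a b c d : R) : 'M[R]_2 :=
  \matrix_(i, j) (nth [::] [:: [:: a; b]; [:: c; d]] i)`_j.

Definition vec2 (a b : R) : plane := \col_i [:: a; b]`_i.

Definition partial (i : 'I_2) (g : plane -> R) (x : plane) : R :=
  'D_(basis_vec i) g x.

Definition gradnorm2 (g : plane -> R) (x : plane) : R :=
  \sum_(i < 2) partial i g x ^+ 2.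

(* Columns are partial derivatives; the library's 'J is defined for maps
   between row vectors and is the transpose of this matrix.               *)
Definition jacmx (F : plane -> plane) (x : plane) : 'M[R]_2 :=
  \matrix_(i, j) partial j (fun y => F y i 0) x.

Definition div2 (F : plane -> plane) (x : plane) : R :=
  \sum_(i < 2) partial i (fun y => F y i 0) x.

Definition curl2 (F : plane -> plane) (x : plane) : R :=
  partial 0 (fun y => F y 1 0) x - partial 1 (fun y => F y 0 0) x.

(* u_t + (u . nabla) u + r e_2 *)
Definition momentum (u : plane -> R -> plane) (r : plane -> R -> R)
    (x : plane) (t : R) : plane :=
  derive1 (u x) t
  + \sum_(j < 2) u x t j 0 *: 'D_(basis_vec j) (u ^~ t) x
  + r x t *: basis_vec 1.

Definition euler_boussinesq_at (u : plane -> R -> plane) (r : plane -> R -> R)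
    (x : plane) (t : R) : Prop :=
  [/\ div2 (u ^~ t) x = 0,
      curl2 (fun y => momentum u r y t) x = 0
    & derive1 (r x) t + \sum_(j < 2) u x t j 0 * partial j (r ^~ t) x = 0].

Definition spacetime_image (phi : plane -> R -> plane) (N : set plane) :
    set (plane * R)%type :=
  [set p | exists2 z, N z & p.1 = phi z p.2].

Definition injectivity_nbhd (D : set plane) (phi : plane -> R -> plane)
    (N : set plane) : Prop :=
  [/\ open N, N `<=` D & forall t, set_inj N (phi ^~ t)].

(* Lagrangian solutions (flow phi, label density rho). The Eulerian fields u, r
   are determined by phi and rho on the space-time image of an injectivity
   neighbourhood N; they are total functions here, with arbitrary values off
   that image. When phi is smooth with nonvanishing Jacobian the image is open,
   so the equations, imposed on the image only, do not see those values.  *)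
Definition euler_boussinesq_solution (D : set plane)
    (phi : plane -> R -> plane) (rho : plane -> R) : Prop :=
  [/\ smooth_on (D `*` [set: R]) (fun p : plane * R => phi p.1 p.2),
      smooth_on D rho,
      (forall z t, D z -> \det (jacmx (phi ^~ t) z) != 0),
      (forall z, D z -> exists2 N, injectivity_nbhd D phi N & N z)
    & forall (N : set plane) (u : plane -> R -> plane) (r : plane -> R -> R),
        injectivity_nbhd D phi N ->
        (forall z t, N z -> derive1 (phi z) t = u (phi z t) t) ->
        (forall z t, N z -> rho z = r (phi z t) t) ->
        [/\ smooth_on (spacetime_image phi N)
              (fun p : plane * R => u p.1 p.2),
            smooth_on (spacetime_image phi N)
              (fun p : plane * R => r p.1 p.2)
          & forall x t, spacetime_image phi N (x, t) ->
              euler_boussinesq_at u r x t]].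

End PlanarCalculus.

(* Main.v *)
Require Import Defs.
From HB Require Import structures.
From mathcomp Require Import all_boot all_order all_algebra.
From mathcomp Require Import all_classical all_reals all_analysis.
From mathcomp Require Import ring lra.
Import Order.TTheory GRing.Theory Num.Theory.
Import numFieldNormedType.Exports.
Local Open Scope classical_set_scope.
Local Open Scope ring_scope.

Set Implicit Arguments.
Unset Strict Implicit.
Unset Printing Implicit Defensive.

(** Write R_t for the rotation by the angle mu t and G = R_t f, so that the flow
    is C (z + G) with C = diag(c, 1/c).  By the anti-Cauchy-Riemann equations the
    z-Jacobian of G is a symmetric traceless matrix with entries p, q, -p, and
    p^2 + q^2 = |grad f1|^2 because rotations preserve it.  Since det C = 1, the
    Jacobian of the flow has determinant 1 - p^2 - q^2 = 1 - |grad f1|^2, at all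
    times.

    Local injectivity, uniformly in t.  If x and y are near z0, the difference of
    their images is C (1 + dG)(x - y) up to a small multiple of |x - y|; the
    inverse of 1 + dG is bounded independently of t because its determinant does
    not depend on t.  This gives |x - y| <= K |flow (x, t) - flow (y, t)| with
    one K for all t ([flow_expansion]).

    The Eulerian fields.  On an injectivity neighbourhood N they are forced:
    u = velocity o unflow and r = density o unflow, where unflow maps (x, t) to
    (z, t) with flow (z, t) = x.  The lower bound makes the space-time image of N
    open: a minimiser of the squared distance from the flow to a nearby target
    over a closed ball is interior, and criticality with an invertible Jacobian
    forces the distance to vanish ([sqdist_flow_critical],
    [flow_locally_onto]).  It also makes unflow Lipschitz, hence differentiable
    ([is_diff_inverse]), and smooth, as its derivatives are smooth functions of
    unflow itself ([smooth_on_autonomous]).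

    The equations.  Differentiation along (u, 1) becomes the time derivative at
    fixed label ([convective_derivative]), so density transport is immediate and
    the momentum is phi_tt + rho e_2 read at the label.  In label coordinates,
    with det the Jacobian determinant above,
      det * div u = 0   and
      det * curl (phi_tt + rho e_2) = (q / c^2) (mu^2 (c^4 - 1) - c0 c),
    the first since det does not depend on time; the second vanishes by the
    choice of mu ([euler_boussinesq_image]). *)

(** * Differentials in epsilon form *)
Section Differentials.
Context {R : realType}.
Implicit Types V W X : normedModType R.

(** The epsilon form of a differential can be composed with Lipschitz bounds,
    which is how it is used for inverse maps. *)
Lemma is_diff_estimate V W (f : V -> W) (L : {linear V -> W}) (x : V) :
  continuous L ->
  (forall e, 0 < e -> \forall h \near (0 : V),
    `|f (h + x) - f x - L h| <= e * `|h|) ->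
  is_diff x f L.
Proof.
move=> cL est.
have exp : f \o shift x = cst (f x) + L +o_ (0 : V) id.
  apply/eqaddoP => e e0; near=> h.
  have -> : (f \o shift x - (cst (f x) + L)) h = f (h + x) - f x - L h.
    by rewrite /= opprD addrA.
  by near: h; exact: est.
have dL := diff_unique cL exp.
apply: DiffDef => //; apply/diff_locallyP.
by rewrite dL.
Unshelve. all: by end_near. Qed.

Lemma differentiable_estimate V W (f : V -> W) (x : V) :
  differentiable f x ->
  forall e, 0 < e -> \forall h \near (0 : V),
    `|f (h + x) - f x - 'd f x h| <= e * `|h|.
Proof.
move=> /diff_locally /eqaddoP est e e0; near=> h.
have -> : f (h + x) - f x - 'd f x h
    = (f \o shift x - (cst (f x) + 'd f x)) h.
  by rewrite /= opprD addrA.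
by near: h; exact: est.
Unshelve. all: by end_near. Qed.

Lemma near_eq_differentiable V W (f g : V -> W) (x : V) :
  (\forall y \near x, f y = g y) -> differentiable f x -> differentiable g x.
Proof.
move=> fg df.
have cdf : continuous ('d f x) by exact: diff_continuous.
suff : is_diff x g ('d f x) by case.
apply: (is_diff_estimate (L := 'd f x)) => // e e0.
have : \forall h \near (0 : V), f (h + x) = g (h + x).
  have := fg; rewrite (near_shift 0 x)/=; apply: filterS => h /=.
  by rewrite subr0.
move=> fg0; near=> h.
rewrite -(nbhs_singleton fg) -(near fg0 h)//.
by near: h; exact: differentiable_estimate.
Unshelve. all: by end_near. Qed.

Lemma derive_comp V W X (f : V -> W) (g : W -> X) (x v : V) :
  differentiable f x -> differentiable g (f x) ->
  'D_v (fun y => g (f y)) x = 'd g (f x) ('D_v f x).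
Proof.
move=> df dg.
have dgf : differentiable (g \o f) x by exact: differentiable_comp.
by rewrite (deriveE v dgf) diff_comp// deriveE.
Qed.

End Differentials.

(** * Closure properties of C^k and smooth functions *)
Section CkCalculus.
Context {R : realType}.
Implicit Types V W X : normedModType R.

Lemma Ck_on_differentiable V W (U : set V) k (g : V -> W) x :
  Ck_on U k.+1 g -> U x -> differentiable g x.
Proof. by move=> [dg _]; exact: dg. Qed.

Lemma Ck_on_S V W (U : set V) k (g : V -> W) : Ck_on U k.+1 g -> Ck_on U k g.
Proof.
elim: k g => [|k IH] g [dg Dg].
  by move=> x Ux; exact/differentiable_continuous/dg.
by split=> // v; exact/IH/Dg.
Qed.

(** Derivatives only see germs, so on an open set a function may be replaced by
    any other one with the same values there. *)
Lemma Ck_on_ext V W (U : set V) k (f g : V -> W) : open U ->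
  (forall x, U x -> f x = g x) -> Ck_on U k f -> Ck_on U k g.
Proof.
move=> oU; elim: k f g => [|k IH] f g fg.
  move=> cf x Ux.
  have fgx : \forall y \near x, f y = g y.
    by near=> y; apply: fg; near: y; exact: open_nbhs_nbhs.
  have cfx : f @ x --> f x by exact: cf.
  rewrite /prop_for /continuous_at -(fg _ Ux).
  by apply: cvg_trans cfx; apply: near_eq_cvg; apply: filterS fgx => y.
move=> [df Df].
have fgx x : U x -> \forall y \near x, f y = g y.
  by move=> Ux; near=> y; apply: fg; near: y; exact: open_nbhs_nbhs.
split=> [x Ux|v]; first exact: near_eq_differentiable (fgx x Ux) (df x Ux).
by apply: (IH ('D_v f)) (Df v) => x Ux; exact/near_eq_derive/fgx.
Unshelve. all: by end_near. Qed.

Lemma Ck_on_cst V W (U : set V) k (c : W) : Ck_on U k (fun _ : V => c).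
Proof.
elim: k c => [c x _|k IH c]; first exact: cst_continuous.
split=> [x _|v]; first exact: differentiable_cst.
have -> : 'D_v (fun _ : V => c) = fun _ => 0.
  by apply/funext => x; exact: derive_cst.
exact: IH.
Qed.

Lemma Ck_onD V W (U : set V) k (f g : V -> W) : open U ->
  Ck_on U k f -> Ck_on U k g -> Ck_on U k (fun x => f x + g x).
Proof.
move=> oU; elim: k f g => [|k IH] f g.
  by move=> cf cg x Ux; apply: continuousD; [exact: cf|exact: cg].
move=> [df Df] [dg Dg]; split=> [x Ux|v].
  by apply: differentiableD; [exact: df|exact: dg].
apply: (Ck_on_ext (f := fun x => 'D_v f x + 'D_v g x) oU) (IH _ _ (Df v) (Dg v)).
move=> x Ux; apply/esym/deriveD; apply: diff_derivable; [exact: df|exact: dg].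
Qed.

Lemma Ck_on_sum V W (U : set V) k (I : finType) (F : I -> V -> W) : open U ->
  (forall i, Ck_on U k (F i)) -> Ck_on U k (fun x => \sum_i F i x).
Proof.
move=> oU CF.
elim: (index_enum I) => [|i s IH].
  have -> : (fun x => \sum_(i <- [::]) F i x) = fun _ => 0.
    by apply/funext => x; rewrite big_nil.
  exact: Ck_on_cst.
have -> : (fun x => \sum_(j <- i :: s) F j x)
        = fun x => F i x + \sum_(j <- s) F j x.
  by apply/funext => x; rewrite big_cons.
exact: Ck_onD.
Qed.

Lemma Ck_on_linear_comp V W X (U : set V) k (L : {linear W -> X}) (g : V -> W) :
  continuous L -> open U -> Ck_on U k g -> Ck_on U k (fun x => L (g x)).
Proof.
move=> cL oU; elim: k g => [|k IH] g.
  by move=> cg x Ux; apply: continuous_comp; [exact: cg|exact: cL].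
move=> [dg Dg]; split=> [x Ux|v].
  by apply: differentiable_comp; [exact: dg|exact: linear_differentiable].
apply: (Ck_on_ext (f := fun x => L ('D_v g x)) oU) (IH _ (Dg v)) => x Ux.
have dL y : differentiable L y by exact: linear_differentiable.
by rewrite [RHS]derive_comp//; [rewrite diff_lin|exact: dg].
Qed.

Lemma Ck_onM V (U : set V) k (f g : V -> R) : open U ->
  Ck_on U k f -> Ck_on U k g -> Ck_on U k (fun x => f x * g x).
Proof.
move=> oU; elim: k f g => [|k IH] f g.
  by move=> cf cg x Ux; apply: continuousM; [exact: cf|exact: cg].
move=> Cf Cg; have [[df Df] [dg Dg]] := (Cf, Cg); split=> [x Ux|v].
  by apply: differentiableM; [exact: df|exact: dg].
apply: (Ck_on_ext (f := fun x => f x * 'D_v g x + g x * 'D_v f x) oU).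
  by move=> x Ux; apply/esym/deriveM; apply: diff_derivable; [exact: df|exact: dg].
apply: Ck_onD => //; apply: IH; [exact: Ck_on_S|exact: Dg|exact: Ck_on_S|exact: Df].
Qed.

Lemma Ck_on_id V (U : set V) k : Ck_on U k (fun x : V => x).
Proof.
case: k => [x _|k]; first exact: cvg_id.
split=> [x _|v]; first by [].
have -> : 'D_v (fun x : V => x) = fun _ => v by apply/funext => x; exact: derive_id.
exact: Ck_on_cst.
Qed.

(** A finite spanning family together with coordinate functionals.  The chain
    rule differentiates the outer function in a direction that moves with the
    point; coordinates trade this for finitely many fixed directions. *)
Definition coordinates W (I : finType) (e : I -> W) (l : I -> {linear W -> R}) :=
  (forall i, continuous (l i)) /\ forall w, w = \sum_i l i w *: e i.

Lemma Ck_on_scalel V W (U : set V) k (a : V -> R) (w : W) : open U ->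
  Ck_on U k a -> Ck_on U k (fun x => a x *: w).
Proof.
move=> oU.
have lin : linear (fun a : R => a *: w) by move=> b x y; rewrite scalerDl scalerA.
pose S : {linear R -> W} :=
  HB.pack (fun a : R => a *: w) (GRing.isLinear.Build _ _ _ _ _ lin).
exact: (Ck_on_linear_comp (L := S) (@scalel_continuous _ _ w) oU).
Qed.

(** The derivative of g o f along v is the sum of the products of the coordinates
    of 'D_v f with the derivatives of g along fixed directions, taken at f; each
    factor is one degree less regular, so the induction hypothesis applies. *)
Lemma Ck_on_comp_scalar V W (U : set V) (U' : set W) I e l k
    (f : V -> W) (g : W -> R) :
  @coordinates W I e l -> open U -> (forall x, U x -> U' (f x)) ->
  Ck_on U k f -> Ck_on U' k g -> Ck_on U k (fun x => g (f x)).
Proof.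
move=> [cl le] oU fU; elim: k f g fU => [|k IH] f g fU.
  move=> cf cg x Ux; apply: continuous_comp; first exact: cf.
  exact/cg/fU.
move=> Cf Cg; have [[df Df] [dg Dg]] := (Cf, Cg); split=> [x Ux|v].
  by apply: (@differentiable_comp _ _ _ _ f g); [exact: df|exact/dg/fU].
apply: (Ck_on_ext (f := fun x => \sum_i l i ('D_v f x) * 'D_(e i) g (f x)) oU).
  move=> x Ux; have dgx := dg _ (fU _ Ux).
  rewrite [RHS]derive_comp//; last exact: df.
  rewrite [X in 'd g _ X]le linear_sum; apply: eq_bigr => i _.
  by rewrite (deriveE (e i) dgx) [RHS]linearZ.
apply: Ck_on_sum => // i; apply: Ck_onM => //.
  exact: Ck_on_linear_comp (cl i) oU (Df v).
exact: (IH f ('D_(e i) g) fU (Ck_on_S Cf) (Dg (e i))).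
Qed.

Lemma Ck_on_comp V W X (U : set V) (U' : set W) I e l J e' l' k
    (f : V -> W) (g : W -> X) :
  @coordinates W I e l -> @coordinates X J e' l' ->
  open U -> open U' -> (forall x, U x -> U' (f x)) ->
  Ck_on U k f -> Ck_on U' k g -> Ck_on U k (fun x => g (f x)).
Proof.
move=> cW [cl' le'] oU oU' fU Cf Cg.
have -> : (fun x => g (f x)) = fun x => \sum_j l' j (g (f x)) *: e' j.
  by apply/funext => x; rewrite -le'.
apply: Ck_on_sum => // j; apply: Ck_on_scalel => //.
apply: (Ck_on_comp_scalar (g := fun y => l' j (g y)) cW oU fU Cf).
exact: Ck_on_linear_comp.
Qed.

Lemma smooth_on_ext V W (U : set V) (f g : V -> W) : open U ->
  (forall x, U x -> f x = g x) -> smooth_on U f -> smooth_on U g.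
Proof. by move=> oU fg Cf k; exact: Ck_on_ext fg (Cf k). Qed.

Lemma smooth_on_differentiable V W (U : set V) (g : V -> W) x :
  smooth_on U g -> U x -> differentiable g x.
Proof. by move=> /(_ 1); exact: Ck_on_differentiable. Qed.

Lemma smooth_on_derive V W (U : set V) (g : V -> W) v :
  smooth_on U g -> smooth_on U ('D_v g).
Proof. by move=> Cg k; have [_] := Cg k.+1; apply. Qed.

Lemma smooth_on_cst V W (U : set V) (c : W) : smooth_on U (fun _ : V => c).
Proof. by move=> k; exact: Ck_on_cst. Qed.

Lemma smooth_on_linear V W (U : set V) (L : {linear V -> W}) :
  continuous L -> open U -> smooth_on U L.
Proof.
move=> cL oU k; apply: (Ck_on_linear_comp cL oU); exact: Ck_on_id.
Qed.

Lemma smooth_onD V W (U : set V) (f g : V -> W) : open U ->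
  smooth_on U f -> smooth_on U g -> smooth_on U (fun x => f x + g x).
Proof. by move=> oU Cf Cg k; exact: Ck_onD. Qed.

Lemma smooth_onM V (U : set V) (f g : V -> R) : open U ->
  smooth_on U f -> smooth_on U g -> smooth_on U (fun x => f x * g x).
Proof. by move=> oU Cf Cg k; exact: Ck_onM. Qed.

Lemma smooth_onN V (U : set V) (f : V -> R) : open U ->
  smooth_on U f -> smooth_on U (fun x => - f x).
Proof.
move=> oU Cf; apply: (smooth_on_ext (f := fun x => -1 * f x)) => //.
  by move=> x _; rewrite mulN1r.
by apply: smooth_onM => //; exact: smooth_on_cst.
Qed.

Lemma smooth_onB V (U : set V) (f g : V -> R) : open U ->
  smooth_on U f -> smooth_on U g -> smooth_on U (fun x => f x - g x).
Proof. by move=> oU Cf Cg; apply: smooth_onD => //; exact: smooth_onN. Qed.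

Lemma smooth_on_scalel V W (U : set V) (a : V -> R) (w : W) : open U ->
  smooth_on U a -> smooth_on U (fun x => a x *: w).
Proof. by move=> oU Ca k; exact: Ck_on_scalel. Qed.

Lemma smooth_on_comp V W X (U : set V) (U' : set W) I e l J e' l'
    (f : V -> W) (g : W -> X) :
  @coordinates W I e l -> @coordinates X J e' l' ->
  open U -> open U' -> (forall x, U x -> U' (f x)) ->
  smooth_on U f -> smooth_on U' g -> smooth_on U (fun x => g (f x)).
Proof. by move=> cW cX oU oU' fU Cf Cg k; exact: (Ck_on_comp cW cX oU oU'). Qed.

(** The derivative of 1 / f is - f' / f^2, so the regularity of 1 / f feeds its
    own induction. *)
Lemma smooth_onV V (U : set V) (f : V -> R) : open U ->
  (forall x, U x -> f x != 0) -> smooth_on U f -> smooth_on U (fun x => (f x)^-1).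
Proof.
move=> oU f0 Cf.
have df x : U x -> differentiable f x by exact: smooth_on_differentiable.
elim=> [|k IH].
  by move=> x Ux; apply: continuousV; [exact: f0|exact/differentiable_continuous/df].
split=> [x Ux|v]; first by apply: differentiableV; [exact: df|exact: f0].
apply: (Ck_on_ext (f := fun x => - 1 * ((f x)^-1 * (f x)^-1 * 'D_v f x)) oU).
  move=> x Ux; rewrite mulN1r.
  rewrite deriveV; [|exact: f0|exact/diff_derivable/df].
  by rewrite /GRing.scale/= mulNr -expr2 exprVn.
have CDf := @smooth_on_derive _ _ _ _ v Cf.
by apply: Ck_onM; [exact: oU|exact: Ck_on_cst|do ?apply: Ck_onM].
Qed.

(** Each of the two functions occurs in the derivative of the other, so they are
    treated by one induction. *)
Lemma smooth_on_cos_sin V (U : set V) (f : V -> R) : open U ->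
  smooth_on U f ->
  smooth_on U (fun x => cos (f x)) /\ smooth_on U (fun x => sin (f x)).
Proof.
move=> oU Cf.
have df x : U x -> differentiable f x by exact: smooth_on_differentiable.
have dcos y : differentiable (@cos R) y by exact/derivable1_diffP/derivable_cos.
have dsin y : differentiable (@sin R) y by exact/derivable1_diffP/derivable_sin.
have both k : Ck_on U k (fun x => cos (f x)) /\ Ck_on U k (fun x => sin (f x)).
  elim: k => [|k [IHc IHs]].
    split=> x Ux.
      apply: continuous_comp; last exact: continuous_cos.
      exact/differentiable_continuous/df.
    apply: continuous_comp; last exact: continuous_sin.
    exact/differentiable_continuous/df.
  have CDf v := @smooth_on_derive _ _ _ _ v Cf.
  split; split=> [x Ux|v].
  - exact: (@differentiable_comp _ _ _ _ f (@cos R) _ (df x Ux)).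
  - apply: (Ck_on_ext (f := fun x => 'D_v f x * (-1 * sin (f x))) oU).
      move=> x Ux; rewrite [RHS]derive_comp//; last exact: df.
      by rewrite diff1E// derive1E derive_val mulN1r.
    by do !apply: Ck_onM => //; [exact: CDf|exact: Ck_on_cst].
  - exact: (@differentiable_comp _ _ _ _ f (@sin R) _ (df x Ux)).
  - apply: (Ck_on_ext (f := fun x => 'D_v f x * cos (f x)) oU).
      move=> x Ux; rewrite [RHS]derive_comp//; last exact: df.
      by rewrite diff1E// derive1E derive_val.
    by apply: Ck_onM => //; exact: CDf.
by split=> k; have [] := both k.
Qed.

End CkCalculus.

(** * Coordinates on columns, scalars and products *)
Section CoordinateSystems.
Context {R : realType}.

Definition col_coord n (i : 'I_n) (x : 'cV[R]_n) : R := x i 0.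

Lemma col_coord_is_linear n (i : 'I_n) : linear (@col_coord n i).
Proof. by move=> a x y; rewrite /col_coord !mxE. Qed.

HB.instance Definition _ n (i : 'I_n) :=
  GRing.isLinear.Build R 'cV[R]_n R _ (@col_coord n i) (@col_coord_is_linear n i).

Lemma coordinates_col n : coordinates (fun i : 'I_n => delta_mx i 0)
  (fun i => @col_coord n i : {linear 'cV[R]_n -> R}).
Proof.
split=> [i|x]; first exact: coord_continuous.
apply/matrixP => i j; rewrite summxE (bigD1 i)//= !mxE ord1 !eqxx mulr1.
rewrite big1 ?addr0// => k ki; rewrite !mxE eq_sym (negbTE ki) mulr0//.
Qed.

Lemma coordinates_scalar :
  coordinates (fun _ : 'I_1 => 1 : R) (fun _ => idfun : {linear R -> R}).
Proof.
split=> [_|x]; first by move=> x; exact: cvg_id.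
by rewrite big_ord1 /GRing.scale/= mulr1.
Qed.

Lemma coordinates_prod (V W : normedModType R) (I J : finType) e l e' l' :
  @coordinates R V I e l -> @coordinates R W J e' l' ->
  coordinates
    (fun s : I + J => match s with inl i => (e i, 0) | inr j => (0, e' j) end)
    (fun s : I + J => match s return {linear (V * W)%type -> R} with
                      | inl i => (l i \o fst)%FUN | inr j => (l' j \o snd)%FUN end).
Proof.
move=> [cl le] [cl' le']; split=> [[i|j]|[v w]].
- move=> x; apply: (@continuous_comp _ _ _ fst (l i)); last exact: cl.
  exact: cvg_fst.
- move=> x; apply: (@continuous_comp _ _ _ snd (l' j)); last exact: cl'.
  exact: cvg_snd.
rewrite big_sumType /= {1}(le v) {1}(le' w).
have inl_sum (s : I -> R) : \sum_i s i *: (e i, 0 : W) = (\sum_i s i *: e i, 0).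
  elim/big_rec2: _ => // i y1 _ _ ->.
  by congr pair; rewrite /= scaler0 addr0.
have inr_sum (s : J -> R) : \sum_i s i *: (0 : V, e' i) = (0, \sum_i s i *: e' i).
  elim/big_rec2: _ => // i y1 _ _ ->.
  by congr pair; rewrite /= scaler0 addr0.
by rewrite inl_sum inr_sum; congr pair; rewrite /= ?addr0 ?add0r.
Qed.

End CoordinateSystems.

(** * Regularity of inverse maps *)
Section InverseMaps.
Context {R : realType} {V W : normedModType R}.
Variables (I : finType) (e : I -> W) (l : I -> {linear W -> R}).
Hypothesis cW : coordinates e l.

(** Put k = Psi p - Psi p0.  Differentiability of H gives
    p - p0 = dH k + o(|k|); applying the inverse L of dH and using that k is
    O(p - p0) yields k = L (p - p0) + o(p - p0).  Here L is given by the preimages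
    w i of the basis vectors e i, which makes its continuity automatic. *)
Lemma is_diff_inverse (H : V -> W) (Psi : W -> V) (p0 : W) (w : I -> V) :
  differentiable H (Psi p0) ->
  (forall v, 'd H (Psi p0) v = 0 -> v = 0) ->
  (forall i, 'd H (Psi p0) (w i) = e i) ->
  (\forall p \near p0, H (Psi p) = p) ->
  (exists2 K, 0 < K & \forall p \near p0,
     `|Psi p - Psi p0| <= K * `|p - p0|) ->
  is_diff p0 Psi (fun p => \sum_i l i p *: w i).
Proof.
move=> dH inj dHw HPsi [K K0 lip].
have [cl le] := cW.
pose L0 p := \sum_i l i p *: w i.
have L0lin : linear L0.
  move=> a x y; rewrite /L0 scaler_sumr -big_split; apply: eq_bigr => i _ /=.
  by rewrite linearP scalerDl scalerA.
pose L : {linear W -> V} := HB.pack L0 (GRing.isLinear.Build _ _ _ _ _ L0lin).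
have cL : continuous L.
  have C0 : Ck_on [set: W] 0 L.
    apply: Ck_on_sum; first exact: openT.
    move=> i; apply: Ck_on_scalel; first exact: openT.
    by move=> x _; exact: cl.
  by move=> x; exact: C0.
(* L is a right inverse of the injective map dH, hence also a left inverse. *)
have LdH v : L ('d H (Psi p0) v) = v.
  apply/subr0_eq/inj; rewrite linearB /= [X in X - _](_ : _ = 'd H (Psi p0) v).
    exact: subrr.
  rewrite /= /L0 linear_sum /= [RHS]le; apply: eq_bigr => i _.
  by rewrite linearZ /= dHw.
have [c c0 Lc] := linear_lipschitz cL.
apply: (is_diff_estimate (L := L)) => // eps eps0.
have eps'0 : 0 < eps / (c * K) by rewrite divr_gt0// mulr_gt0.
have /nbhs_ballP[d /= d0 Hd] := differentiable_estimate dH eps'0.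
have HP0 : H (Psi p0) = p0 := nbhs_singleton HPsi.
have shift0 (P : set W) : (\forall p \near p0, P p) ->
    \forall h \near (0 : W), P (h + p0).
  by rewrite (near_shift 0 p0) => HP; apply: filterS HP => h /=; rewrite subr0.
have := shift0 _ HPsi; have := shift0 _ lip => {}lip {}HPsi.
near=> h.
have HPh : H (Psi (h + p0)) = h + p0 by near: h.
set k := Psi (h + p0) - Psi p0.
have kh : `|k| <= K * `|h|.
  have : `|Psi (h + p0) - Psi p0| <= K * `|h + p0 - p0| by near: h.
  by rewrite addrK.
have bk : ball 0 d k.
  rewrite -ball_normE /= sub0r normrN (le_lt_trans kh)// mulrC -ltr_pdivlMr//.
  rewrite -[h]subr0 -normrN opprB sub0r.
  near: h; apply/nbhs_ballP; exists (d / K) => /=; first exact: divr_gt0.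
  by move=> h; rewrite -ball_normE /= sub0r.
have := Hd _ bk; rewrite /= /k subrK HPh HP0 addrK -/k => est.
have -> : k - L h = - L (h - 'd H (Psi p0) k).
  by rewrite [L (h - _)]linearB LdH opprB.
rewrite normrN (le_trans (Lc _))//.
rewrite (le_trans (ler_wpM2l (ltW c0) est))//.
rewrite (le_trans (ler_wpM2l (ltW c0) (ler_wpM2l (ltW eps'0) kh)))//.
rewrite le_eqVlt; apply/orP; left; apply/eqP; field.
by rewrite !gt_eqF.
Unshelve. all: by end_near. Qed.

(** Bootstrapping: when the first derivatives of Psi are smooth functions of Psi,
    a C^k map Psi has C^k first derivatives, hence is C^k.+1. *)
Lemma smooth_on_autonomous (J : finType) e' l' (E : set W) (Omega : set V)
    (Psi : W -> V) (F : I -> V -> V) :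
  @coordinates R V J e' l' -> open E -> open Omega ->
  (forall p, E p -> Omega (Psi p)) ->
  (forall p, E p -> differentiable Psi p) ->
  (forall i p, E p -> 'D_(e i) Psi p = F i (Psi p)) ->
  (forall i, smooth_on Omega (F i)) ->
  smooth_on E Psi.
Proof.
move=> cV oE oO EO dPsi DPsi SF.
elim=> [|k IH]; first by move=> p Ep; exact/differentiable_continuous/dPsi.
split=> [|v]; first exact: dPsi.
have [cl le] := cW.
apply: (Ck_on_ext (f := fun p => \sum_i l i v *: F i (Psi p)) oE).
  move=> p Ep; have dp := dPsi _ Ep.
  rewrite (deriveE v dp) [in RHS](le v) linear_sum; apply: eq_bigr => i _.
  by rewrite linearZ -(deriveE (e i) dp) DPsi.
apply: Ck_on_sum => // i.
apply: (Ck_on_linear_comp (@scaler_continuous _ _ (l i v)) oE).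
exact: (Ck_on_comp cV cV oE oO EO IH (SF i k)).
Qed.

End InverseMaps.

(** * Strict differentiability *)
Section StrictDifferentiability.
Context {R : realType}.
Implicit Types V W : normedModType R.

(** Both difference quotients are the same function of the increment. *)
Lemma is_derive_line V W (f : V -> W) (y v : V) (s : R) :
  derivable f (s *: v + y) v ->
  is_derive s 1 (fun s => f (s *: v + y)) ('D_v f (s *: v + y)).
Proof.
move=> df.
have E : (fun h : R => h^-1 *: (((fun s => f (s *: v + y)) \o shift s) (h *: 1)
                                - f (s *: v + y)))
       = fun h : R => h^-1 *: ((f \o shift (s *: v + y)) (h *: v) - f (s *: v + y)).
  by apply/funext => h /=; rewrite addrA -scalerDl [_%:A]mulr1.
by apply: DeriveDef; [rewrite /derivable E|rewrite /derive E].
Qed.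

Lemma ball_segment V (z x y : V) (r s : R) :
  ball z r x -> ball z r y -> 0 <= s <= 1 -> ball z r (s *: (x - y) + y).
Proof.
rewrite -!ball_normE /= => xr yr /andP[s0 s1].
have -> : z - (s *: (x - y) + y) = s *: (z - x) + (1 - s) *: (z - y).
  have E : z - x - (z - y) = - (x - y) by rewrite !opprB addrC subrKA.
  by rewrite scalerBl scale1r addrCA -scalerBr E scalerN opprD addrA addrAC.
have [->|sn0] := eqVneq s 0; first by rewrite scale0r add0r subr0 scale1r.
have sgt0 : 0 < s by rewrite lt_def sn0.
rewrite (le_lt_trans (ler_normD _ _))// !normrZ.
rewrite (ger0_norm s0) ger0_norm ?subr_ge0//.
rewrite [ltRHS](_ : _ = s * r + (1 - s) * r); last by rewrite -mulrDl subrKC mul1r.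
by rewrite ltr_leD ?ltr_pM2l// ler_wpM2l ?subr_ge0// ltW.
Qed.

(** The mean value theorem on the segment from y to x writes f x - f y as a
    derivative along x - y at an intermediate point; the directional derivatives
    along the basis are continuous, so they differ little from those at z. *)
Lemma strict_differentiable V (I : finType) e l (D : set V) (f : V -> R) (z : V) :
  @coordinates R V I e l -> open D -> D z -> Ck_on D 1 f ->
  forall eps : R, 0 < eps -> exists r, [/\ 0 < r, ball z r `<=` D &
    forall x y, ball z r x -> ball z r y ->
      `|f x - f y - 'd f z (x - y)| <= eps * `|x - y|].
Proof.
move=> [cl le] oD Dz [df Cdf] eps eps0.
pose c i := sval (cid2 (linear_lipschitz (cl i))).
have c0 i : 0 < c i by rewrite /c; case: cid2.
have lc i v : `|l i v| <= c i * `|v| by rewrite /c; case: cid2.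
(* The summand 1 keeps C positive when the family of coordinates is empty. *)
pose C := 1 + \sum_i c i.
have C0 : 0 < C by rewrite ltr_wpDr// sumr_ge0// => i _; exact: ltW.
have epsC : 0 < eps / C by exact: divr_gt0.
have nD : \forall x \near z, D x by exact: open_nbhs_nbhs.
have nd : \forall x \near z, forall i, `|'D_(e i) f x - 'D_(e i) f z| <= eps / C.
  apply: filter_forall => i; have := Cdf (e i) z Dz.
  by move=> /cvgrPdist_le /(_ _ epsC); apply: filterS => x; rewrite distrC.
have /nbhs_ballP[r /= r0 Hr] : \forall x \near z, D x /\
    forall i, `|'D_(e i) f x - 'D_(e i) f z| <= eps / C by exact: filterI.
exists r; split => // [x /Hr[]//|x y zx zy].
set v := x - y; pose g (s : R) := f (s *: v + y).
have inD (s : R) : 0 <= s <= 1 -> ball z r (s *: v + y) by exact: ball_segment.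
have dg (s : R) : 0 <= s <= 1 -> is_derive s (1 : R) g ('D_v f (s *: v + y)).
  move=> s01; apply/is_derive_line/diff_derivable/df.
  by have [] := Hr _ (inD _ s01).
have [|||s] := @MVT_segment R g (fun s => 'D_v f (s *: v + y)) 0 1.
- exact: ler01.
- by move=> s; rewrite in_itv/= => /andP[s0 s1]; apply: dg; rewrite !ltW.
- apply: derivable_within_continuous => s; rewrite in_itv/= => s01.
  by have [] := dg _ s01.
rewrite in_itv/= => s01; rewrite /g scale1r scale0r add0r subr0 mulr1 /v subrK.
move=> ->; have [Ds nds] := Hr _ (inD _ s01); rewrite -/v.
have expand a : D a -> 'd f a v = \sum_i l i v *: 'D_(e i) f a.
  move=> Da; rewrite {1}(le v) linear_sum; apply: eq_bigr => i _.
  by rewrite linearZ /= (deriveE _ (df _ Da)).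
rewrite (deriveE v (df _ Ds)) !expand// -sumrB.
rewrite (le_trans (ler_norm_sum _ _ _))//.
apply: (@le_trans _ _ (\sum_i (c i * `|v|) * (eps / C))).
  by apply: ler_sum => i _; rewrite -scalerBr normrZ ler_pM.
rewrite -!mulr_suml.
have -> : (\sum_i c i) * `|v| * (eps / C) = eps * `|v| * ((\sum_i c i) / C).
  by rewrite !mulrA; ring.
rewrite ler_piMr ?mulr_ge0 ?(ltW eps0)//.
by rewrite ler_pdivrMr// mul1r /C lerDr.
Qed.

End StrictDifferentiability.

(** * Rotating an anti-Cauchy-Riemann pair *)
Section RotatingPair.
Context {R : realType}.
Local Notation plane := 'cV[R]_2.
Local Notation spacetime := (plane * R)%type.

Lemma coordinates_spacetime :
  coordinates
    (fun s : 'I_2 + 'I_1 => match s with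
       inl i => (basis_vec R i, 0) | inr _ => (0, 1) end : spacetime)
    (fun s => match s return {linear spacetime -> R} with
       inl i => (@col_coord R 2 i \o fst)%FUN | inr _ => (idfun \o snd)%FUN end).
Proof. exact: (coordinates_prod (coordinates_col 2) coordinates_scalar). Qed.

Lemma open_cylinder (V W : topologicalType) (U : set V) :
  open U -> open (U `*` [set: W]).
Proof.
move=> oU; rewrite (_ : _ `*` _ = fst @^-1` U); last first.
  by apply/seteqP; split=> [[v w] []|[v w]].
by apply: open_comp => // -[v w] _; exact: cvg_fst.
Qed.

Lemma smooth_on_fst (U : set plane) (f : plane -> R) : open U ->
  smooth_on U f -> smooth_on (U `*` [set: R]) (fun q : spacetime => f q.1).
Proof.
move=> oU; have oUR := @open_cylinder _ R _ oU.
apply: (smooth_on_comp (f := fst) (coordinates_col 2) coordinates_scalar) => //.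
  by move=> q [].
apply: smooth_on_linear oUR => -[v w]; exact: cvg_fst.
Qed.

Lemma smooth_on_snd (U : set plane) : open U ->
  smooth_on (U `*` [set: R]) (fun q : spacetime => q.2).
Proof.
move=> oU; have oUR := @open_cylinder _ R _ oU.
by apply: (smooth_on_linear (L := snd) _ oUR) => -[v w]; exact: cvg_snd.
Qed.

Lemma diff_partial (f : plane -> R) (z v : plane) : differentiable f z ->
  'd f z v = v 0 0 * partial 0 f z + v 1 0 * partial 1 f z.
Proof.
move=> df; have [_ le] := coordinates_col (R := R) 2.
rewrite [X in 'd f _ X]le linear_sum !big_ord_recl big_ord0 addr0 !linearZ /=.
rewrite (_ : lift ord0 ord0 = 1); last exact/val_inj.
by rewrite /partial !deriveE.
Qed.

Lemma is_derive_linear (V W : normedModType R) (L : {linear V -> W}) (q v : V) :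
  continuous L -> is_derive q v L (L v).
Proof.
move=> cL; have dL : differentiable L q by exact: linear_differentiable.
by apply: DeriveDef; [exact: diff_derivable|rewrite deriveE// diff_lin].
Qed.

Lemma is_derive_spacetime_fst (f : plane -> R) (q v : spacetime) :
  differentiable f q.1 ->
  is_derive q v (fun q : spacetime => f q.1)
    (v.1 0 0 * partial 0 f q.1 + v.1 1 0 * partial 1 f q.1).
Proof.
move=> df.
have cfst : continuous (@fst plane R) by move=> [? ?]; exact: cvg_fst.
have dfst : differentiable (@fst plane R) q by exact: linear_differentiable.
have dc : differentiable (fun q : spacetime => f q.1) q.
  exact: (@differentiable_comp _ _ _ _ fst f).
apply: DeriveDef; first exact: diff_derivable.
by rewrite derive_comp// deriveE// diff_lin// diff_partial.
Qed.

Lemma is_derive_spacetime_snd (q v : spacetime) :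
  is_derive q v (fun q : spacetime => q.2) v.2.
Proof. by apply: (is_derive_linear (L := snd)) => -[? ?]; exact: cvg_snd. Qed.

Section AntiCauchyRiemann.
Variables (mu : R) (D : set plane) (f1 f2 : plane -> R).
Hypotheses (oD : open D) (sf1 : smooth_on D f1) (sf2 : smooth_on D f2).
Hypothesis aCR1 : forall z, D z -> partial 0 f1 z + partial 1 f2 z = 0.
Hypothesis aCR2 : forall z, D z -> partial 1 f1 z - partial 0 f2 z = 0.

(** The pair (rot1, rot2) is (f1, f2) rotated by the angle mu t. *)
Definition rot1 (q : spacetime) : R :=
  cos (mu * q.2) * f1 q.1 - sin (mu * q.2) * f2 q.1.
Definition rot2 (q : spacetime) : R :=
  sin (mu * q.2) * f1 q.1 + cos (mu * q.2) * f2 q.1.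
(** By the anti-Cauchy-Riemann equations the Jacobian in z of (rot1, rot2) is the
    symmetric traceless matrix with diagonal rot_diag, - rot_diag and
    off-diagonal entries rot_off; see is_derive_rot. *)
Definition rot_diag (q : spacetime) : R :=
  cos (mu * q.2) * partial 0 f1 q.1 - sin (mu * q.2) * partial 1 f1 q.1.
Definition rot_off (q : spacetime) : R :=
  sin (mu * q.2) * partial 0 f1 q.1 + cos (mu * q.2) * partial 1 f1 q.1.

Local Notation cyl := (D `*` [set: R]).

Let oC : open cyl. Proof. exact: open_cylinder. Qed.

Let smooth_cos_sin : smooth_on cyl (fun q => cos (mu * q.2)) /\
  smooth_on cyl (fun q => sin (mu * q.2)).
Proof.
apply: smooth_on_cos_sin => //; apply: smooth_onM => //.
  exact: smooth_on_cst.
exact: smooth_on_snd.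
Qed.

Lemma smooth_rot1 : smooth_on cyl rot1.
Proof.
have [sc ss] := smooth_cos_sin.
by apply: smooth_onB => //; apply: smooth_onM => //; exact: smooth_on_fst.
Qed.

Lemma smooth_rot2 : smooth_on cyl rot2.
Proof.
have [sc ss] := smooth_cos_sin.
by apply: smooth_onD => //; apply: smooth_onM => //; exact: smooth_on_fst.
Qed.

Lemma smooth_rot_diag : smooth_on cyl rot_diag.
Proof.
have [sc ss] := smooth_cos_sin.
by apply: smooth_onB => //; apply: smooth_onM => //; apply: smooth_on_fst => //;
  exact: smooth_on_derive.
Qed.

Lemma smooth_rot_off : smooth_on cyl rot_off.
Proof.
have [sc ss] := smooth_cos_sin.
by apply: smooth_onD => //; apply: smooth_onM => //; apply: smooth_on_fst => //;
  exact: smooth_on_derive.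
Qed.

(** A rotation preserves the length of the gradient, which removes the time
    dependence. *)
Lemma rot_det (q : spacetime) :
  rot_diag q ^+ 2 + rot_off q ^+ 2 = gradnorm2 f1 q.1.
Proof.
have -> : gradnorm2 f1 q.1 = partial 0 f1 q.1 ^+ 2 + partial 1 f1 q.1 ^+ 2.
  rewrite /gradnorm2 big_ord_recl big_ord1.
  by congr (_ + partial _ _ _ ^+ 2); exact/val_inj.
have := cos2Dsin2 (mu * q.2); rewrite /rot_diag /rot_off.
set c := cos _; set s := sin _; set a := partial _ _ _; set b := partial _ _ _.
move=> cs; transitivity ((c ^+ 2 + s ^+ 2) * (a ^+ 2 + b ^+ 2)); first by ring.
by rewrite cs mul1r.
Qed.

Let is_derive_cos_sin (q v : spacetime) :
  is_derive q v (fun q : spacetime => cos (mu * q.2))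
    (- sin (mu * q.2) * (mu * v.2)) /\
  is_derive q v (fun q : spacetime => sin (mu * q.2))
    (cos (mu * q.2) * (mu * v.2)).
Proof.
have H := is_derive_spacetime_snd q v.
have Hm : is_derive q v (fun q : spacetime => mu * q.2) (mu * v.2).
  exact: (@is_deriveZ _ _ _ snd mu q v v.2 H).
have dm : differentiable (fun q : spacetime => mu * q.2) q.
  apply: (@differentiableZ _ _ _ snd); apply: linear_differentiable.
  by move=> -[? ?]; exact: cvg_snd.
have dc y : differentiable (@cos R) y by exact/derivable1_diffP/derivable_cos.
have ds y : differentiable (@sin R) y by exact/derivable1_diffP/derivable_sin.
split; apply: DeriveDef.
- apply: diff_derivable; exact: (@differentiable_comp _ _ _ _ _ (@cos R)).
- rewrite derive_comp// diff1E// derive1E !derive_val.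
  by rewrite /GRing.scale/= mulrC.
- apply: diff_derivable; exact: (@differentiable_comp _ _ _ _ _ (@sin R)).
- rewrite derive_comp// diff1E// derive1E !derive_val.
  by rewrite /GRing.scale/= mulrC.
Qed.

Lemma is_derive_rot (q v : spacetime) : D q.1 ->
  is_derive q v rot1
    (rot_diag q * v.1 0 0 + rot_off q * v.1 1 0 - mu * v.2 * rot2 q) /\
  is_derive q v rot2
    (rot_off q * v.1 0 0 - rot_diag q * v.1 1 0 + mu * v.2 * rot1 q).
Proof.
move=> Dq.
have [dc ds] := is_derive_cos_sin q v.
have d1 := is_derive_spacetime_fst v (smooth_on_differentiable sf1 Dq).
have d2 := is_derive_spacetime_fst v (smooth_on_differentiable sf2 Dq).
have e1 : partial 1 f2 q.1 = - partial 0 f1 q.1.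
  by apply/eqP; rewrite -addr_eq0 addrC; apply/eqP/aCR1.
have e2 : partial 0 f2 q.1 = partial 1 f1 q.1 by apply/esym/subr0_eq/aCR2.
split.
- apply: is_derive_eq (is_deriveB (is_deriveM dc d1) (is_deriveM ds d2)) _.
  rewrite e1 e2 /rot_diag /rot_off /rot2 /GRing.scale/=.
  move: (cos _) (sin _) (partial 0 f1 _) (partial 1 f1 _) (f1 _) (f2 _) => *.
  by ring.
- apply: is_derive_eq (is_deriveD (is_deriveM ds d1) (is_deriveM dc d2)) _.
  rewrite e1 e2 /rot_diag /rot_off /rot1 /GRing.scale/=.
  move: (cos _) (sin _) (partial 0 f1 _) (partial 1 f1 _) (f1 _) (f2 _) => *.
  by ring.
Qed.

End AntiCauchyRiemann.
End RotatingPair.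

(** * The supremum norm on the plane and on space-time *)
Section ColumnNorm.
Context {R : realType}.
Local Notation plane := 'cV[R]_2.

Lemma ord2P (P : 'I_2 -> Prop) : P 0 -> P 1 -> forall i, P i.
Proof.
by move=> P0 P1 [[|[|//]] Hi]; [move: P0|move: P1]; congr P; exact/val_inj.
Qed.

Lemma plane_eqP (x y : plane) : x 0 0 = y 0 0 -> x 1 0 = y 1 0 -> x = y.
Proof.
by move=> H0 H1; apply/matrixP => i j; rewrite (ord1 j); move: i; exact: ord2P.
Qed.

Lemma coord_norm_le (x : plane) i : `|x i 0| <= `|x|.
Proof.
rewrite [leRHS]/Num.Def.normr/= mx_normrE.
by apply: (le_bigmax _ (fun ij => `|x ij.1 ij.2|) (i, 0)).
Qed.

Lemma plane_norm_le (x : plane) c : `|x 0 0| <= c -> `|x 1 0| <= c -> `|x| <= c.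
Proof.
move=> H0 H1; have c0 : 0 <= c by exact: le_trans H0.
rewrite [leLHS]/Num.Def.normr/= mx_normrE.
apply/bigmax_leP; split=> // -[i j] _ /=; rewrite (ord1 j).
by move: i; exact: ord2P.
Qed.

Lemma pair_norm (V W : normedModType R) (v : V) (w : W) :
  `|(v, w)| = Num.max `|v| `|w|.
Proof. by []. Qed.

Lemma fst_norm_le (V W : normedModType R) (p : V * W) : `|p.1| <= `|p|.
Proof. by case: p => v w; rewrite pair_norm le_max lexx. Qed.

Lemma snd_norm_le (V W : normedModType R) (p : V * W) : `|p.2| <= `|p|.
Proof. by case: p => v w; rewrite pair_norm le_max lexx orbT. Qed.

Lemma vec2_0 (a b : R) : vec2 a b 0 0 = a. Proof. by rewrite !mxE. Qed.
Lemma vec2_1 (a b : R) : vec2 a b 1 0 = b. Proof. by rewrite !mxE. Qed.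

Lemma vec2E (x : plane) : x = vec2 (x 0 0) (x 1 0).
Proof. by apply: plane_eqP; rewrite ?vec2_0 ?vec2_1. Qed.

Lemma plane_closed_ball_compact (z : plane) r :
  compact [set x : plane | `|x - z| <= r].
Proof.
pose A : set (R * R) := `[z 0 0 - r, z 0 0 + r] `*` `[z 1 0 - r, z 1 0 + r].
pose F (q : R * R) : plane := q.1 *: basis_vec R 0 + q.2 *: basis_vec R 1.
have FE a b : F (a, b) = vec2 a b.
  apply: plane_eqP; rewrite ?vec2_0 ?vec2_1 !mxE /= ?mulr1 ?mulr0 ?addr0 ?add0r//.
rewrite (_ : [set x : plane | _] = F @` A).
  apply: continuous_compact.
    apply: continuous_subspaceT => q; apply: cvgD.
      by apply: cvgZr_tmp; exact: cvg_fst.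
    by apply: cvgZr_tmp; exact: cvg_snd.
  by apply: compact_setX; exact: segment_compact.
apply/seteqP; split=> [x /= xz|_ [[a b] [/= + +] <-]].
  exists (x 0 0, x 1 0); last by rewrite FE -vec2E.
  have := le_trans (coord_norm_le (x - z) 0) xz.
  have := le_trans (coord_norm_le (x - z) 1) xz.
  by rewrite !mxE !ler_distl /A /= !in_itv /= => -> ->.
rewrite !in_itv /= => a01 b01; rewrite FE; apply: plane_norm_le.
  by rewrite !mxE /= ler_distl.
by rewrite !mxE /= ler_distl.
Qed.

End ColumnNorm.

(** * Partial derivatives as directional derivatives on space-time *)
Section SliceCalculus.
Context {R : realType}.
Implicit Types V W X : normedModType R.
Local Notation plane := 'cV[R]_2.

(** Together with derive1_slice_snd: derivatives in space at fixed time, and in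
    time at a fixed point, are derivatives on space-time along (e, 0) and (0, 1).
    The difference quotients coincide. *)
Lemma derive_slice_fst V W X (F : V * W -> X) (z e : V) (t : W) :
  'D_e (fun z => F (z, t)) z = 'D_((e, 0) : V * W) F (z, t).
Proof.
have E : (fun h : R =>
            h^-1 *: (((fun z => F (z, t)) \o shift z) (h *: e) - F (z, t)))
       = fun h : R => h^-1 *: ((F \o shift (z, t)) (h *: (e, 0)) - F (z, t)).
  apply/funext => h /=; congr (_ *: (F _ - _)).
  by congr pair; rewrite /= scaler0 add0r.
by rewrite /derive E.
Qed.

Lemma derive1_slice_snd V X (F : V * R -> X) (z : V) (t : R) :
  derive1 (fun s => F (z, s)) t = 'D_((0, 1) : V * R) F (z, t).
Proof.
have E : (fun h : R =>
            h^-1 *: (((fun s => F (z, s)) \o shift t) (h *: 1) - F (z, t)))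
       = fun h : R => h^-1 *: ((F \o shift (z, t)) (h *: (0, 1)) - F (z, t)).
  apply/funext => h /=; congr (_ *: (F _ - _)).
  by congr pair; rewrite /= scaler0 add0r.
by rewrite derive1E /derive E.
Qed.

Lemma is_derive_vec2 V (a b : V -> R) (q v : V) da db :
  is_derive q v a da -> is_derive q v b db ->
  is_derive q v (fun q => vec2 (a q) (b q)) (vec2 da db).
Proof.
move=> [Da <-] [Db <-].
have dd : derivable (fun q => vec2 (a q) (b q)) q v.
  apply/derivable_mxP => i j; rewrite (ord1 j); move: i.
  apply: (ord2P (P := fun i => derivable (fun x => vec2 (a x) (b x) i 0) q v)).
    by rewrite (_ : (fun _ => _) = a)//; apply/funext => x; rewrite vec2_0.
  by rewrite (_ : (fun _ => _) = b)//; apply/funext => x; rewrite vec2_1.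
apply: DeriveDef => //; rewrite derive_mx//; apply: plane_eqP.
  rewrite vec2_0 mxE; congr ('D_v _ q).
  by apply/funext => x; rewrite vec2_0.
rewrite vec2_1 mxE; congr ('D_v _ q).
by apply/funext => x; rewrite vec2_1.
Qed.

Lemma smooth_on_vec2 V (U : set V) (a b : V -> R) : open U ->
  smooth_on U a -> smooth_on U b -> smooth_on U (fun q => vec2 (a q) (b q)).
Proof.
move=> oU sa sb.
apply: (@smooth_on_ext _ _ _ _
  (fun q => a q *: basis_vec R 0 + b q *: basis_vec R 1)) => //.
  move=> q _; apply: plane_eqP; rewrite ?vec2_0 ?vec2_1 !mxE /=.
    by rewrite mulr1 mulr0 addr0.
  by rewrite mulr1 mulr0 add0r.
by apply: smooth_onD => //; exact: smooth_on_scalel.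
Qed.

Lemma differentiable_lipschitz V W (f : V -> W) x : differentiable f x ->
  exists2 K, 0 < K & \forall h \near (0 : V), `|f (h + x) - f x| <= K * `|h|.
Proof.
move=> df; have cdf : continuous ('d f x) by exact: diff_continuous.
have [c c0 dc] := linear_lipschitz cdf.
exists (1 + c); first by rewrite addr_gt0.
near=> h.
rewrite -(subrK ('d f x h) (f (h + x) - f x)) (le_trans (ler_normD _ _))//.
rewrite mulrDl lerD//; near: h.
exact: differentiable_estimate.
Unshelve. all: by end_near. Qed.

Lemma local_min_derive V (m : V -> R) (z e : V) :
  (\forall y \near z, differentiable m y /\ m z <= m y) -> 'D_e m z = 0.
Proof.
move=> near_min.
have cl : {for (0 : R), continuous (fun s : R => s *: e + z)}.
  apply: (@continuousD _ _ _ (fun s : R => s *: e) (cst z)).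
    exact: scalel_continuous.
  exact: cst_continuous.
have : \forall s \near (0 : R),
    differentiable m (s *: e + z) /\ m z <= m (s *: e + z).
  have near_min0 : nbhs (0 *: e + z) [set y | differentiable m y /\ m z <= m y].
    by rewrite scale0r add0r.
  exact: (cl _ near_min0).
move=> /nbhs_ballP[r /= r0 Hr].
have {}Hr s : s \in `]- r, r[ ->
    differentiable m (s *: e + z) /\ m z <= m (s *: e + z).
  rewrite in_itv /= => /andP[sr rs]; apply: (Hr s).
  by rewrite -ball_normE /= sub0r normrN ltr_norml sr.
have dg s : s \in `]- r, r[ ->
    is_derive s 1 (fun s => m (s *: e + z)) ('D_e m (s *: e + z)).
  by move=> /Hr[dm _]; apply/is_derive_line/diff_derivable.
have i0 : (0 : R) \in `]- r, r[ by rewrite in_itv /= oppr_lt0 r0.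
have [|||s sr|] := @derive1_at_min R (fun s => m (s *: e + z)) (- r) r 0.
- by rewrite ge0_cp// ltW.
- by move=> s /dg[].
- exact: i0.
- by rewrite scale0r add0r; have [] := Hr _ sr.
by have [_ ->] := dg _ i0; rewrite scale0r add0r.
Qed.

End SliceCalculus.

(** * The flow: Jacobian and local injectivity *)
Section StrainedFlow.
Context {R : realType}.
Local Notation plane := 'cV[R]_2.
Local Notation spacetime := (plane * R)%type.
Variables (mu c : R) (D : set plane) (f1 f2 : plane -> R).
Hypothesis c_gt0 : 0 < c.
Hypotheses (oD : open D) (sf1 : smooth_on D f1) (sf2 : smooth_on D f2).
Hypothesis aCR1 : forall z, D z -> partial 0 f1 z + partial 1 f2 z = 0.
Hypothesis aCR2 : forall z, D z -> partial 1 f1 z - partial 0 f2 z = 0.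
Hypothesis nondeg : forall z, D z -> 1 - gradnorm2 f1 z != 0.

Local Notation rot1 := (rot1 mu f1 f2).
Local Notation rot2 := (rot2 mu f1 f2).
Local Notation rot_diag := (rot_diag mu f1).
Local Notation rot_off := (rot_off mu f1).
Local Notation cyl := (D `*` [set: R]).

Let oC : open cyl. Proof. exact: open_cylinder. Qed.
Let c_neq0 : c != 0. Proof. by rewrite gt_eqF. Qed.

Definition flow1 (q : spacetime) : R := c * (q.1 0 0 + rot1 q).
Definition flow2 (q : spacetime) : R := c^-1 * (q.1 1 0 + rot2 q).
Definition flow (q : spacetime) : plane := vec2 (flow1 q) (flow2 q).

Lemma flowE (z : plane) (t : R) :
  mx22 c 0 0 (1 / c) *m
    (row_mx 1%:M (mx22 (cos (mu * t)) (- sin (mu * t))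
                       (sin (mu * t)) (cos (mu * t))) *m
     col_mx z (vec2 (f1 z) (f2 z))) = flow (z, t).
Proof.
rewrite mul_row_col mul1mx; apply: plane_eqP.
  rewrite vec2_0 !mxE !big_ord_recl !big_ord0 !mxE !big_ord_recl !big_ord0 !mxE /=.
  by rewrite /flow1 /rot1 /=; ring.
rewrite vec2_1 !mxE !big_ord_recl !big_ord0 !mxE !big_ord_recl !big_ord0 !mxE /=.
by rewrite /flow2 /rot2 /= (_ : lift ord0 ord0 = 1); [field|exact/val_inj].
Qed.

Let is_derive_coord (i : 'I_2) (q v : spacetime) :
  is_derive q v (fun q : spacetime => q.1 i 0) (v.1 i 0).
Proof.
apply: (is_derive_linear (L := (@col_coord R 2 i \o fst)%FUN)) => x.
apply: (@continuous_comp _ _ _ fst (@col_coord R 2 i)); first exact: cvg_fst.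
exact: coord_continuous.
Qed.

Let smooth_coord (i : 'I_2) : smooth_on cyl (fun q : spacetime => q.1 i 0).
Proof.
apply: (@smooth_on_linear _ _ _ _ (@col_coord R 2 i \o fst)%FUN) => // x.
apply: (@continuous_comp _ _ _ fst (@col_coord R 2 i)); first exact: cvg_fst.
exact: coord_continuous.
Qed.

Lemma is_derive_flow1 (q v : spacetime) : D q.1 ->
  is_derive q v flow1 (c * ((1 + rot_diag q) * v.1 0 0 + rot_off q * v.1 1 0
                            - mu * v.2 * rot2 q)).
Proof.
move=> Dq; have [d1 _] := is_derive_rot mu sf1 sf2 aCR1 aCR2 v Dq.
apply: is_derive_eq (is_deriveZ c (is_deriveD (is_derive_coord 0 q v) d1)) _.
by rewrite /GRing.scale/=; ring.
Qed.

Lemma is_derive_flow2 (q v : spacetime) : D q.1 ->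
  is_derive q v flow2 (c^-1 * (rot_off q * v.1 0 0 + (1 - rot_diag q) * v.1 1 0
                            + mu * v.2 * rot1 q)).
Proof.
move=> Dq; have [_ d2] := is_derive_rot mu sf1 sf2 aCR1 aCR2 v Dq.
apply: is_derive_eq (is_deriveZ c^-1 (is_deriveD (is_derive_coord 1 q v) d2)) _.
by rewrite /GRing.scale/=; ring.
Qed.

Lemma smooth_flow1 : smooth_on cyl flow1.
Proof.
apply: smooth_onM => //; first exact: smooth_on_cst.
by apply: smooth_onD => //; exact: smooth_rot1.
Qed.

Lemma smooth_flow2 : smooth_on cyl flow2.
Proof.
apply: smooth_onM => //; first exact: smooth_on_cst.
by apply: smooth_onD => //; exact: smooth_rot2.
Qed.

Lemma smooth_flow : smooth_on cyl flow.
Proof. exact: smooth_on_vec2 smooth_flow1 smooth_flow2. Qed.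

Lemma det_mx22 (A : 'M[R]_2) : \det A = A 0 0 * A 1 1 - A 0 1 * A 1 0.
Proof.
rewrite (expand_det_row _ 0) !big_ord_recl big_ord0 /cofactor !det_mx11 !mxE /=.
rewrite expr0 expr1 mul1r mulN1r addr0 mulrN.
by congr (_ * A _ _ - A _ _ * A _ _); exact/val_inj.
Qed.

Lemma jacmx_det (z : plane) (t : R) : D z ->
  \det (jacmx (fun z => flow (z, t)) z) = 1 - gradnorm2 f1 z.
Proof.
move=> Dz.
have E1 : (fun y => flow (y, t) 0 0) = fun y => flow1 (y, t).
  by apply/funext => y; rewrite vec2_0.
have E2 : (fun y => flow (y, t) 1 0) = fun y => flow2 (y, t).
  by apply/funext => y; rewrite vec2_1.
have p1 i : partial i (fun y => flow (y, t) 0 0) z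
    = 'D_((basis_vec R i, 0) : spacetime) flow1 (z, t).
  by rewrite E1 /partial derive_slice_fst.
have p2 i : partial i (fun y => flow (y, t) 1 0) z
    = 'D_((basis_vec R i, 0) : spacetime) flow2 (z, t).
  by rewrite E2 /partial derive_slice_fst.
rewrite det_mx22 !mxE !p1 !p2.
do 4!(rewrite ?(@derive_val _ _ _ _ _ _ _ (is_derive_flow1 _ _))
              ?(@derive_val _ _ _ _ _ _ _ (is_derive_flow2 _ _))//).
rewrite !mxE /= -(rot_det mu f1 (z, t)).
by field.
Qed.

Lemma rot_bound (q : spacetime) :
  `|rot_diag q| <= `|partial 0 f1 q.1| + `|partial 1 f1 q.1| /\
  `|rot_off q| <= `|partial 0 f1 q.1| + `|partial 1 f1 q.1|.
Proof.
have cos1 : `|cos (mu * q.2)| <= 1 by rewrite ler_norml cos_geN1 cos_le1.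
have sin1 : `|sin (mu * q.2)| <= 1 by rewrite ler_norml sin_geN1 sin_le1.
have bound u w : `|u| <= 1 -> `|w| <= 1 -> forall a b : R,
    `|u * a| + `|w * b| <= `|a| + `|b|.
  by move=> u1 w1 a b; rewrite !normrM lerD// ler_piMl.
split; first by rewrite (le_trans (ler_normB _ _))// bound.
by rewrite (le_trans (ler_normD _ _))// bound.
Qed.

(** Cramer's rule for the matrix with rows (1 + p, q) and (q, 1 - p): its cofactors
    are bounded by 1 + m, so the inverse is controlled by the determinant alone. *)
Lemma perturbed_inverse (p q k0 k1 y0 y1 m B : R) :
  (1 + p) * k0 + q * k1 = y0 -> q * k0 + (1 - p) * k1 = y1 ->
  `|p| <= m -> `|q| <= m -> `|y0| <= B -> `|y1| <= B ->
  `|1 - (p ^+ 2 + q ^+ 2)| * `|k0| <= 2 * (1 + m) * B /\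
  `|1 - (p ^+ 2 + q ^+ 2)| * `|k1| <= 2 * (1 + m) * B.
Proof.
move=> e0 e1 pm qm y0B y1B.
have m0 : 0 <= m by exact: le_trans pm.
have B0 : 0 <= B by exact: le_trans y0B.
have bnd u v x y : `|u| <= 1 + m -> `|v| <= 1 + m -> `|x| <= B -> `|y| <= B ->
    `|u * x - v * y| <= 2 * (1 + m) * B.
  move=> um vm xB yB; rewrite (le_trans (ler_normB _ _))// !normrM.
  rewrite (_ : 2 * (1 + m) * B = (1 + m) * B + (1 + m) * B); last by ring.
  by rewrite lerD// ler_pM.
have p1 : `|1 + p| <= 1 + m by rewrite (le_trans (ler_normD _ _))// normr1 lerD2l.
have p2 : `|1 - p| <= 1 + m by rewrite (le_trans (ler_normB _ _))// normr1 lerD2l.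
have q1 : `|q| <= 1 + m by rewrite (le_trans qm)// lerDr.
rewrite -!normrM; split.
  rewrite (_ : _ * k0 = (1 - p) * y0 - q * y1); first exact: bnd.
  by rewrite -e0 -e1; ring.
rewrite (_ : _ * k1 = (1 + p) * y1 - q * y0); first exact: bnd.
by rewrite -e0 -e1; ring.
Qed.

Lemma rotated_error_le (q : spacetime) (u w e : R) : `|u| <= e -> `|w| <= e ->
  `|cos (mu * q.2) * u - sin (mu * q.2) * w| <= 2 * e /\
  `|sin (mu * q.2) * u + cos (mu * q.2) * w| <= 2 * e.
Proof.
have : `|cos (mu * q.2)| <= 1 by rewrite ler_norml cos_geN1 cos_le1.
have : `|sin (mu * q.2)| <= 1 by rewrite ler_norml sin_geN1 sin_le1.
move: (cos _) (sin _) => a b b1 a1 ue we.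
have bound x y : `|x| <= 1 -> `|y| <= 1 -> `|x * u| + `|y * w| <= 2 * e.
  move=> x1 y1; rewrite !normrM (_ : 2 * e = 1 * e + 1 * e); last by ring.
  by rewrite lerD// ler_pM.
split; first by rewrite (le_trans (ler_normB _ _))// bound.
by rewrite (le_trans (ler_normD _ _))// bound.
Qed.

Let absorb_half (a u : R) : a <= u + 1 / 2 * a -> a <= 2 * u.
Proof. by lra. Qed.

(** With k = x - y, strict differentiability of f1 and f2 at z0 gives
    (1 + dG) k = C^-1 (difference of the images) + error, |error| <= 2 eps |k|.
    By perturbed_inverse the chosen eps lets the error absorb at most half of |k|,
    and no constant depends on t. *)
Lemma flow_expansion (z0 : plane) : D z0 ->
  exists r K : R, [/\ 0 < r, 0 < K, ball z0 r `<=` D &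
    forall x y t, ball z0 r x -> ball z0 r y ->
      `|x - y| <= K * `|flow (x, t) - flow (y, t)|].
Proof.
move=> Dz; have df1 := smooth_on_differentiable sf1 Dz.
have df2 := smooth_on_differentiable sf2 Dz.
pose m := `|partial 0 f1 z0| + `|partial 1 f1 z0|.
have m0 : 0 <= m by rewrite addr_ge0.
pose dt := `|1 - gradnorm2 f1 z0|.
have dt0 : 0 < dt by rewrite normr_gt0 nondeg.
(* perturbed_inverse loses the factor 2 (1 + m) and the error is 2 eps |k|; this
   eps makes the product equal to dt |k| / 2. *)
pose eps := dt / (8 * (1 + m)).
have m1 : 0 < 1 + m by rewrite ltr_wpDr.
have eps0 : 0 < eps by rewrite divr_gt0// mulr_gt0.
have [r1 [r10 r1D H1]] :=
  strict_differentiable (coordinates_col 2) oD Dz (sf1 1) eps0.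
have [r2 [r20 r2D H2]] :=
  strict_differentiable (coordinates_col 2) oD Dz (sf2 1) eps0.
pose C := c + c^-1.
have C0 : 0 < C by rewrite addr_gt0// invr_gt0.
exists (Num.min r1 r2), (4 * (1 + m) * C / dt); split.
- by rewrite lt_min r10.
- by rewrite divr_gt0// !mulr_gt0.
- by apply: subset_trans r1D; apply: le_ball; rewrite ge_min lexx.
move=> x y t zx zy.
have x1 : ball z0 r1 x by apply: le_ball zx; rewrite ge_min lexx.
have y1 : ball z0 r1 y by apply: le_ball zy; rewrite ge_min lexx.
have x2 : ball z0 r2 x by apply: le_ball zx; rewrite ge_min lexx orbT.
have y2 : ball z0 r2 y by apply: le_ball zy; rewrite ge_min lexx orbT.
have {}H1 := H1 _ _ x1 y1; have {}H2 := H2 _ _ x2 y2.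
set k := x - y in H1 H2 *.
set e1 := f1 x - f1 y - _ in H1; set e2 := f2 x - f2 y - _ in H2.
set d := flow (x, t) - flow (y, t).
have d1 : d 0 0 = flow1 (x, t) - flow1 (y, t) by rewrite !mxE.
have d2 : d 1 0 = flow2 (x, t) - flow2 (y, t) by rewrite !mxE.
pose E1 := cos (mu * t) * e1 - sin (mu * t) * e2.
pose E2 := sin (mu * t) * e1 + cos (mu * t) * e2.
have b1 : partial 1 f2 z0 = - partial 0 f1 z0.
  by apply/eqP; rewrite -addr_eq0 addrC; apply/eqP/aCR1.
have b2 : partial 0 f2 z0 = partial 1 f1 z0 by apply/esym/subr0_eq/aCR2.
have k0E : k 0 0 = x 0 0 - y 0 0 by rewrite !mxE.
have k1E : k 1 0 = x 1 0 - y 1 0 by rewrite !mxE.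
have eq1 : (1 + rot_diag (z0, t)) * k 0 0 + rot_off (z0, t) * k 1 0
           = c^-1 * d 0 0 - E1.
  rewrite d1 /E1 /e1 /e2 !diff_partial// b1 b2 k0E k1E.
  rewrite /flow1 /rot1 /rot_diag /rot_off /=.
  move: (cos _) (sin _) (partial 0 f1 z0) (partial 1 f1 z0) (f1 x) (f1 y).
  by move: (f2 x) (f2 y) (x 0 0) (y 0 0) (x 1 0) (y 1 0) => *; field.
have eq2 : rot_off (z0, t) * k 0 0 + (1 - rot_diag (z0, t)) * k 1 0
           = c * d 1 0 - E2.
  rewrite d2 /E2 /e1 /e2 !diff_partial// b1 b2 k0E k1E.
  rewrite /flow2 /rot2 /rot_diag /rot_off /=.
  move: (cos _) (sin _) (partial 0 f1 z0) (partial 1 f1 z0) (f1 x) (f1 y).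
  by move: (f2 x) (f2 y) (x 0 0) (y 0 0) (x 1 0) (y 1 0) => *; field.
have [Ebound1 Ebound2] := rotated_error_le (z0, t) H1 H2.
have [pm qm] := rot_bound (z0, t).
pose B := C * `|d| + 2 * (eps * `|k|).
have y1B : `|c^-1 * d 0 0 - E1| <= B.
  rewrite (le_trans (ler_normB _ _))// lerD//.
    by rewrite normrM ler_pM ?coord_norm_le// gtr0_norm ?invr_gt0// lerDr ltW.
have y2B : `|c * d 1 0 - E2| <= B.
  rewrite (le_trans (ler_normB _ _))// lerD//.
    by rewrite normrM ler_pM ?coord_norm_le// gtr0_norm// lerDl invr_ge0 ltW.
have [K0 K1] := perturbed_inverse eq1 eq2 pm qm y1B y2B.
rewrite rot_det -/dt -/m /= in K0 K1.
have key : `|k| <= 2 * (1 + m) * B / dt.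
  by apply: plane_norm_le; rewrite ler_pdivlMr// mulrC.
have expand : 2 * (1 + m) * B / dt = 2 * (1 + m) * C / dt * `|d| + 1 / 2 * `|k|.
  by rewrite /B /eps; field; rewrite !gt_eqF.
rewrite expand in key.
rewrite (_ : 4 * (1 + m) * C / dt * `|d| = 2 * (2 * (1 + m) * C / dt * `|d|)).
  exact: absorb_half.
by field; rewrite gt_eqF.
Qed.

(** * Openness of the space-time image *)
Definition sqdist_flow (x : plane) (q : spacetime) : R :=
  (flow1 q - x 0 0) * (flow1 q - x 0 0) + (flow2 q - x 1 0) * (flow2 q - x 1 0).

Lemma smooth_sqdist_flow x : smooth_on cyl (sqdist_flow x).
Proof.
have s1 : smooth_on cyl (fun q => flow1 q - x 0 0).
  by apply: smooth_onB => //; [exact: smooth_flow1|exact: smooth_on_cst].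
have s2 : smooth_on cyl (fun q => flow2 q - x 1 0).
  by apply: smooth_onB => //; [exact: smooth_flow2|exact: smooth_on_cst].
by apply: smooth_onD => //; exact: smooth_onM.
Qed.

Let differentiable_slice (V : normedModType R) (F : spacetime -> V)
    (z : plane) (t : R) :
  differentiable F (z, t) -> differentiable (fun y => F (y, t)) z.
Proof.
by move=> dF; apply: (@differentiable_comp _ _ _ _ (fun y => (y, t)) F) => //.
Qed.

(** The gradient of the squared distance is the transpose of the Jacobian applied
    to twice the displacement flow (z, t) - x; the Jacobian is invertible, so the
    displacement vanishes at a critical point. *)
Lemma sqdist_flow_critical (x z : plane) (t : R) : D z ->
  (\forall y \near z, sqdist_flow x (z, t) <= sqdist_flow x (y, t)) ->
  flow (z, t) = x.
Proof.
move=> Dz zmin.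
have crit e : 'D_e (fun y => sqdist_flow x (y, t)) z = 0.
  apply: local_min_derive; near=> y; split; last by near: y.
  apply/differentiable_slice/(smooth_on_differentiable (smooth_sqdist_flow x)).
  by split=> //; near: y; exact: open_nbhs_nbhs.
have {}crit (e : plane) : 2 * (flow1 (z, t) - x 0 0)
      * (c * ((1 + rot_diag (z, t)) * e 0 0 + rot_off (z, t) * e 1 0))
    + 2 * (flow2 (z, t) - x 1 0)
      * (c^-1 * (rot_off (z, t) * e 0 0 + (1 - rot_diag (z, t)) * e 1 0)) = 0.
  rewrite -(crit e) derive_slice_fst.
  have d1 := is_deriveB (is_derive_flow1 (e, 0) (Dz : D (z, t).1))
                        (is_derive_cst (x 0 0) (z, t) (e, 0)).
  have d2 := is_deriveB (is_derive_flow2 (e, 0) (Dz : D (z, t).1))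
                        (is_derive_cst (x 1 0) (z, t) (e, 0)).
  have [_ ->] := is_deriveD (is_deriveM d1 d1) (is_deriveM d2 d2).
  have valB f a : (f - cst a) (z, t) = f (z, t) - a :> R by [].
  rewrite /GRing.scale/= !valB !subr0 !mulr0 !mul0r addr0 subr0.
  by move: (flow1 _) (flow2 _) (rot_diag _) (rot_off _) => *; ring.
have := crit (basis_vec R 0); have := crit (basis_vec R 1).
rewrite !mxE /= !mulr1 !mulr0 !addr0 !add0r => crit1 crit0.
have det_neq0 : 1 - (rot_diag (z, t) ^+ 2 + rot_off (z, t) ^+ 2) != 0.
  by rewrite rot_det; exact: nondeg.
have two_neq0 : 2 != 0 :> R by rewrite pnatr_eq0.
apply: plane_eqP; rewrite ?vec2_0 ?vec2_1; apply/subr0_eq.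
  apply: (mulfI det_neq0); apply: (mulfI two_neq0); apply: (mulfI c_neq0).
  have := congr2 (fun u v => (1 - rot_diag (z, t)) * u - rot_off (z, t) * v)
    crit0 crit1.
  rewrite /= !mulr0 subr0 => <-.
  by move: (flow1 _) (flow2 _) (rot_diag _) (rot_off _) => *; ring.
apply: (mulfI det_neq0); apply: (mulfI two_neq0); apply: (mulfI (invr_neq0 c_neq0)).
have := congr2 (fun u v => (1 + rot_diag (z, t)) * u - rot_off (z, t) * v)
  crit1 crit0.
rewrite /= !mulr0 subr0 => <-.
by move: (flow1 _) (flow2 _) (rot_diag _) (rot_off _) => *; ring.
Unshelve. all: by end_near. Qed.

Let sum_sqr_norm_le (u v d : R) : 0 < d -> u * u + v * v <= 2 * (d * d) ->
  `|u| <= 2 * d /\ `|v| <= 2 * d.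
Proof. by move=> d0 uv; rewrite !ler_norml; split; apply/andP; split; nra. Qed.

Let norm_sum_sqr_le (u v d : R) : `|u| <= d -> `|v| <= d ->
  u * u + v * v <= 2 * (d * d).
Proof. by rewrite !ler_norml => /andP[? ?] /andP[? ?]; nra. Qed.

(** Minimise the squared distance to x over the closed ball of radius r about z0.
    At the minimiser the distance is at most 2 delta, at z0 at most delta, hence by
    flow_expansion the minimiser lies at distance less than 3 K delta = r from z0:
    it is interior, and critical.  The same bound gives the Lipschitz estimate. *)
Lemma flow_locally_onto (N : set plane) (z0 : plane) (t0 : R) :
  open N -> N `<=` D -> N z0 ->
  exists2 K, 0 < K & \forall p \near (flow (z0, t0), t0), exists z,
    [/\ N z, p.1 = flow (z, p.2) & `|z - z0| <= K * `|p - (flow (z0, t0), t0)|].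
Proof.
move=> oN ND Nz0; have Dz0 := ND _ Nz0.
have [r1 [K [r10 K0 r1D expand]]] := flow_expansion Dz0.
have /nbhs_ballP[r2 /= r20 r2N] : nbhs z0 N by exact: open_nbhs_nbhs.
pose r := Num.min r1 r2 / 2.
have min0 : 0 < Num.min r1 r2 by rewrite lt_min r10.
have r0 : 0 < r by rewrite divr_gt0.
have ball_r z : `|z - z0| <= r -> ball z0 r1 z /\ N z.
  move=> zr; have : ball z0 (Num.min r1 r2) z.
    by rewrite -ball_normE /= distrC (le_lt_trans zr)// /r; lra.
  move=> bz; split; first by apply: le_ball bz; rewrite ge_min lexx.
  by apply: r2N; apply: le_ball bz; rewrite ge_min lexx orbT.
have z0r1 : ball z0 r1 z0 by exact: ballxx.
have dflow : differentiable flow (z0, t0).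
  exact: (smooth_on_differentiable smooth_flow).
have [K1 K10 lip] := differentiable_lipschitz dflow.
pose K2 := K1 + 1.
have K20 : 0 < K2 by rewrite addr_gt0.
have center : \forall p \near (flow (z0, t0), t0),
    `|p.1 - flow (z0, p.2)| <= K2 * `|p - (flow (z0, t0), t0)|.
  have /nbhs_ballP[d /= d0 Hd] := lip.
  apply/nbhs_ballP; exists d => // -[x t]; rewrite -ball_normE /= distrC => xt.
  set p := (x, t) - _ in xt *.
  have tt0 : `|(0, t - t0) : spacetime| <= `|p|.
    by rewrite pair_norm ge_max normr0 normr_ge0 (snd_norm_le p).
  have {}Hd : `|flow (z0, t) - flow (z0, t0)| <= K1 * `|p|.
    have := Hd ((0, t - t0) : spacetime); rewrite -ball_normE /= sub0r normrN.
    move=> /(_ (le_lt_trans tt0 xt)).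
    rewrite (_ : (0, t - t0) + (z0, t0) = (z0, t)); last first.
      by congr pair; rewrite /= ?add0r ?subrK.
    by move=> /le_trans; apply; rewrite ler_pM2l.
  rewrite -(subrKA (flow (z0, t0))) (le_trans (ler_normD _ _))//.
  by rewrite /K2 mulrDl mul1r addrC lerD// ?(fst_norm_le p)// distrC.
(* 3 delta bounds |flow (z, t) - flow (z0, t)| at a minimiser z, and
   K * 3 delta = r. *)
pose delta := r / (3 * K).
have delta0 : 0 < delta by rewrite divr_gt0// mulr_gt0.
exists (K * K2); first exact: mulr_gt0.
have small : \forall p \near (flow (z0, t0), t0),
    K2 * `|p - (flow (z0, t0), t0)| < delta.
  apply/nbhs_ballP; exists (delta / K2) => /=; first exact: divr_gt0.
  by move=> p; rewrite -ball_normE /= distrC ltr_pdivlMr// mulrC.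
near=> p.
have cp : `|p.1 - flow (z0, p.2)| <= K2 * `|p - (flow (z0, t0), t0)| by near: p.
have sp : K2 * `|p - (flow (z0, t0), t0)| < delta by near: p.
set x := p.1 in cp *; set t := p.2 in cp *.
have csp := le_lt_trans cp sp.
pose A := [set z : plane | `|z - z0| <= r].
have [|||z /set_mem Az zmin] :=
  @compact_EVT_min plane R (fun y => sqdist_flow x (y, t)) A.
- by exists z0; rewrite /A /= subrr normr0 ltW.
- exact: plane_closed_ball_compact.
- apply: continuous_in_subspaceT => y /set_mem /ball_r [_ Ny].
  apply/differentiable_continuous/differentiable_slice.
  by apply: (smooth_on_differentiable (smooth_sqdist_flow x)); split=> //; exact: ND.
have [zr1 Nz] := ball_r _ Az.
have z0A : z0 \in A by rewrite inE /A /= subrr normr0 ltW.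
have coordE y i : (flow (y, t) - x) i 0 = flow (y, t) i 0 - x i 0 by rewrite !mxE.
have resz0 : sqdist_flow x (z0, t) <= 2 * (delta * delta).
  have d0 : `|flow (z0, t) - x| <= delta by rewrite distrC ltW.
  have := norm_sum_sqr_le (le_trans (coord_norm_le _ 0) d0)
                          (le_trans (coord_norm_le _ 1) d0).
  by rewrite !coordE vec2_0 vec2_1.
have dz : `|flow (z, t) - x| <= 2 * delta.
  have [u v] := sum_sqr_norm_le delta0 (le_trans (zmin _ z0A) resz0).
  by apply: plane_norm_le; rewrite coordE ?vec2_0 ?vec2_1.
have zr : `|z - z0| < r.
  rewrite (le_lt_trans (expand _ _ t zr1 z0r1))//.
  rewrite -(subrKA x) (le_lt_trans (ler_wpM2l (ltW K0) (ler_normD _ _)))//.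
  rewrite (_ : r = K * (2 * delta + delta)); last first.
    by rewrite /delta; field; rewrite gt_eqF.
  by rewrite ltr_pM2l// ler_ltD.
have flowz : flow (z, t) = x.
  apply: sqdist_flow_critical; first exact: ND.
  have near_r : \forall y \near z, `|y - z0| < r.
    apply/nbhs_ballP; exists (r - `|z - z0|) => /=; first by rewrite subr_gt0.
    move=> y; rewrite -ball_normE /= distrC ltrBrDr.
    by apply: le_lt_trans; rewrite -(subrKA z) ler_normD.
  by apply: filterS near_r => y yr; apply: zmin; rewrite inE /A /= ltW.
exists z; split => //.
rewrite (le_trans (expand _ _ t zr1 z0r1))// flowz -mulrA ler_pM2l//.
Unshelve. all: by end_near. Qed.

(** * The inverse of the flow on space-time *)

(** The differential at q of the space-time map (z, t) |-> (flow (z, t), t). *)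
Definition flow_jac (q v : spacetime) : spacetime :=
  (vec2 (c * ((1 + rot_diag q) * v.1 0 0 + rot_off q * v.1 1 0
              - mu * v.2 * rot2 q))
        (c^-1 * (rot_off q * v.1 0 0 + (1 - rot_diag q) * v.1 1 0
                 + mu * v.2 * rot1 q)), v.2).

Definition jac_det (q : spacetime) : R := 1 - (rot_diag q ^+ 2 + rot_off q ^+ 2).

(** Cramer's rule for flow_jac q, after moving the time component to the right-hand
    side and undoing the strain diag(c, 1/c). *)
Definition flow_jac_inv (q v : spacetime) : spacetime :=
  let y1 := c^-1 * v.1 0 0 + mu * v.2 * rot2 q in
  let y2 := c * v.1 1 0 - mu * v.2 * rot1 q in
  (vec2 ((jac_det q)^-1 * ((1 - rot_diag q) * y1 - rot_off q * y2))
        ((jac_det q)^-1 * ((1 + rot_diag q) * y2 - rot_off q * y1)), v.2).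

Lemma jac_det_neq0 q : D q.1 -> jac_det q != 0.
Proof. by move=> Dq; rewrite /jac_det rot_det; exact: nondeg. Qed.

Lemma flow_jacK q v : D q.1 -> flow_jac_inv q (flow_jac q v) = v.
Proof.
move=> /jac_det_neq0 dn0; rewrite /flow_jac_inv /flow_jac /= !vec2_0 !vec2_1.
move: v => [k tau] /=; congr pair; apply: plane_eqP; rewrite ?vec2_0 ?vec2_1.
  apply: (mulfI dn0); rewrite mulVKf//; move: dn0; rewrite /jac_det.
  by move: (rot_diag _) (rot_off _) (rot1 _) (rot2 _) => *; field.
apply: (mulfI dn0); rewrite mulVKf//; move: dn0; rewrite /jac_det.
by move: (rot_diag _) (rot_off _) (rot1 _) (rot2 _) => *; field.
Qed.

Lemma flow_jac_invK q v : D q.1 -> flow_jac q (flow_jac_inv q v) = v.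
Proof.
move=> /jac_det_neq0 dn0; rewrite /flow_jac_inv /flow_jac /= !vec2_0 !vec2_1.
move: v => [k tau] /=; congr pair; apply: plane_eqP; rewrite ?vec2_0 ?vec2_1.
  move: dn0; rewrite /jac_det.
  by move: (rot_diag _) (rot_off _) (rot1 _) (rot2 _) => *; field; apply/andP.
move: dn0; rewrite /jac_det.
by move: (rot_diag _) (rot_off _) (rot1 _) (rot2 _) => *; field; apply/andP.
Qed.

Lemma smooth_flow_jac_inv v : smooth_on cyl (flow_jac_inv ^~ v).
Proof.
have sc := @smooth_on_cst _ _ R cyl.
have s1 : smooth_on cyl rot1 by exact: smooth_rot1.
have s2 : smooth_on cyl rot2 by exact: smooth_rot2.
have sd : smooth_on cyl rot_diag by exact: smooth_rot_diag.
have so : smooth_on cyl rot_off by exact: smooth_rot_off.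
have sy1 : smooth_on cyl (fun q => c^-1 * v.1 0 0 + mu * v.2 * rot2 q).
  by apply: smooth_onD => //; apply: smooth_onM.
have sy2 : smooth_on cyl (fun q => c * v.1 1 0 - mu * v.2 * rot1 q).
  by apply: smooth_onB => //; apply: smooth_onM.
have sj : smooth_on cyl (fun q => (jac_det q)^-1).
  apply: smooth_onV => //; first by move=> q [Dq _]; exact: jac_det_neq0.
  apply: smooth_onB => //; apply: smooth_onD => //; exact: smooth_onM.
apply: (@smooth_on_ext _ _ _ _ (fun q =>
    ((flow_jac_inv q v).1 0 0) *: ((basis_vec R 0, 0) : spacetime)
    + ((flow_jac_inv q v).1 1 0) *: ((basis_vec R 1, 0) : spacetime)
    + (0, v.2))) => //.
  move=> q _; rewrite /flow_jac_inv /= vec2_0 vec2_1.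
  congr pair; last by rewrite /= !scaler0 !add0r.
  apply: plane_eqP; rewrite /= ?vec2_0 ?vec2_1 !mxE /=.
    by rewrite mulr1 mulr0 !addr0.
  by rewrite mulr1 mulr0 add0r addr0.
apply: smooth_onD => //; last exact: smooth_on_cst.
apply: smooth_onD => //; apply: smooth_on_scalel => //.
  apply: (@smooth_on_ext _ _ _ _ (fun q => (jac_det q)^-1 *
    ((1 - rot_diag q) * (c^-1 * v.1 0 0 + mu * v.2 * rot2 q)
     - rot_off q * (c * v.1 1 0 - mu * v.2 * rot1 q)))) => //.
    by move=> q _; rewrite /flow_jac_inv /= vec2_0.
  by apply: smooth_onM => //; apply: smooth_onB => //; apply: smooth_onM => //;
    exact: smooth_onB.
apply: (@smooth_on_ext _ _ _ _ (fun q => (jac_det q)^-1 *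
    ((1 + rot_diag q) * (c * v.1 1 0 - mu * v.2 * rot1 q)
     - rot_off q * (c^-1 * v.1 0 0 + mu * v.2 * rot2 q)))) => //.
  by move=> q _; rewrite /flow_jac_inv /= vec2_1.
by apply: smooth_onM => //; apply: smooth_onB => //; apply: smooth_onM => //;
  exact: smooth_onD.
Qed.

Lemma is_derive_flow q v : D q.1 -> is_derive q v flow (flow_jac q v).1.
Proof.
move=> Dq; apply: is_derive_vec2; first exact: is_derive_flow1.
exact: is_derive_flow2.
Qed.

Lemma diff_spacetime_flow q v : D q.1 ->
  differentiable (fun q => (flow q, q.2)) q /\
  'd (fun q => (flow q, q.2)) q v = flow_jac q v.
Proof.
move=> Dq; have df : differentiable flow q.
  by apply: (smooth_on_differentiable smooth_flow); case: q Dq.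
have cs : continuous (@snd plane R) by move=> [? ?]; exact: cvg_snd.
have ds : differentiable (@snd plane R) q by exact: linear_differentiable.
split; first exact: differentiable_pair.
rewrite diff_pair// diff_lin// -deriveE//.
by have [_ ->] := is_derive_flow v Dq.
Qed.

(** The lower bound of flow_expansion holds with the same radius for all times. *)
Lemma flow_locally_injective z : D z ->
  exists2 N, injectivity_nbhd D (fun z t => flow (z, t)) N & N z.
Proof.
move=> /flow_expansion[r [K [r0 K0 rD expand]]].
exists (ball z r); last exact: ballxx.
split; [exact: ball_open|exact: rD|].
move=> t x y /set_mem xr /set_mem yr /= xy.
have := expand _ _ t xr yr; rewrite xy subrr normr0 mulr0 normr_le0 subr_eq0.
by move=> /eqP.
Qed.

Section LabelField.
Variable N : set plane.
Hypothesis injN : injectivity_nbhd D (fun z t => flow (z, t)) N.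

Let oN : open N. Proof. by case: injN. Qed.
Let ND : N `<=` D. Proof. by case: injN. Qed.

Local Notation image := (spacetime_image (fun z t => flow (z, t)) N).

(** The label of a space-time point is the particle that occupies it; the default
    value 0 is only taken off the image. *)
Definition label (p : spacetime) : plane :=
  xget 0 [set z | N z /\ p.1 = flow (z, p.2)].
Definition unflow (p : spacetime) : spacetime := (label p, p.2).

Lemma labelP p : image p -> N (label p) /\ p.1 = flow (unflow p).
Proof.
move=> [z Nz pz]; rewrite /unflow /label.
by case: xgetP => [y -> //|/(_ z)]; case; split.
Qed.

Lemma label_eq p z : N z -> p.1 = flow (z, p.2) -> label p = z.
Proof.
move=> Nz pz; have [Nl pl] : N (label p) /\ p.1 = flow (unflow p).
  by apply: labelP; exists z.
have [_ _ /(_ p.2 (label p) z (mem_set Nl) (mem_set Nz))] := injN.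
by apply; rewrite -pz.
Qed.

Lemma image_unflow p : image p -> cyl (unflow p).
Proof. by move=> /labelP[Nl _]; split=> //; exact: ND. Qed.

Let near_label p0 : image p0 -> exists2 K, 0 < K &
  \forall p \near p0, image p /\ `|label p - label p0| <= K * `|p - p0|.
Proof.
move=> /labelP[Nl pl].
have -> : p0 = (flow (label p0, p0.2), p0.2).
  by rewrite {1}(surjective_pairing p0) pl.
rewrite (@label_eq _ (label p0))//.
have [K K0 near_onto] := flow_locally_onto p0.2 oN ND Nl.
exists K => //; apply: filterS near_onto => p [z [Nz pz zl]].
by split; [exists z|rewrite (label_eq Nz pz)].
Qed.

Lemma open_image : open image.
Proof.
rewrite openE => p /near_label[K _ near_image].
by apply: filterS near_image => q [].
Qed.

(** The inverse function theorem at a point of the image: near_label supplies the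
    Lipschitz bound and flow_jac_inv the inverse of the differential. *)
Lemma diff_unflow p v : image p ->
  differentiable unflow p /\ 'd unflow p v = flow_jac_inv (unflow p) v.
Proof.
move=> Ep; have [Du _] := image_unflow Ep.
have [dH _] := diff_spacetime_flow 0 Du.
have dHE w : 'd (fun q => (flow q, q.2)) (unflow p) w = flow_jac (unflow p) w.
  by have [] := diff_spacetime_flow w Du.
have inj0 : flow_jac_inv (unflow p) 0 = 0.
  rewrite /flow_jac_inv /= !mxE !mulr0 !mul0r addr0 subr0 !mulr0 subr0 mulr0.
  by congr pair; apply: plane_eqP; rewrite ?vec2_0 ?vec2_1 !mxE.
have [cs le] := coordinates_spacetime (R := R).
pose e (s : 'I_2 + 'I_1) : spacetime :=
  match s with inl i => (basis_vec R i, 0) | inr _ => (0, 1) end.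
have [] := is_diff_inverse coordinates_spacetime (Psi := unflow)
  (w := fun s => flow_jac_inv (unflow p) (e s)) dH.
- by move=> w; rewrite dHE => w0; rewrite -(flow_jacK w Du) w0 inj0.
- by move=> s; rewrite dHE flow_jac_invK.
- apply: filterS (open_nbhs_nbhs (conj open_image Ep)) => q /labelP[_ ql] /=.
  by rewrite -ql -surjective_pairing.
- have [K K0 near_lip] := near_label Ep.
  exists (K + 1); first by rewrite addr_gt0.
  apply: filterS near_lip => q [_ lip].
  rewrite pair_norm ge_max mulrDl mul1r (le_trans lip) ?lerDl//=.
  by rewrite (le_trans (snd_norm_le (q - p)))// lerDr mulr_ge0// ltW.
move=> du duE; split; first exact: du.
have -> : 'd unflow p v = _ := congr1 (@^~ v) duE.
rewrite -[LHS](flow_jacK _ Du) -dHE linear_sum; congr (flow_jac_inv _ _).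
rewrite [RHS]le; apply: eq_bigr => s _.
by rewrite linearZ /= dHE flow_jac_invK.
Qed.

Lemma smooth_unflow : smooth_on image unflow.
Proof.
apply: (smooth_on_autonomous coordinates_spacetime (Omega := cyl) (F := fun s q =>
  flow_jac_inv q (match s with inl i => (basis_vec R i, 0) | inr _ => (0, 1) end))
  coordinates_spacetime open_image oC).
- exact: image_unflow.
- by move=> p Ep; have [] := diff_unflow 0 Ep.
- move=> s p Ep.
  set v := match s with inl i => _ | inr _ => _ end.
  by have [du <-] := diff_unflow v Ep; rewrite deriveE.
- by move=> s; exact: smooth_flow_jac_inv.
Qed.

Variable c0 : R.
Hypothesis mu_eq : mu ^+ 2 * (c ^+ 4 - 1) = c0 * c.

(** * The Eulerian equations *)

(** These are the fields at a label: phi_t, the density, and the two components of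
    phi_tt + rho e_2. *)
Definition velocity (q : spacetime) : plane :=
  vec2 (- (c * mu) * rot2 q) (c^-1 * mu * rot1 q).

Definition density (q : spacetime) : R := c0 * q.1 1 0.

Definition force1 (q : spacetime) : R := - (c * mu ^+ 2) * rot1 q.
Definition force2 (q : spacetime) : R := - (c^-1 * mu ^+ 2) * rot2 q + density q.

Lemma smooth_velocity : smooth_on cyl velocity.
Proof.
have s1 : smooth_on cyl rot1 by exact: smooth_rot1.
have s2 : smooth_on cyl rot2 by exact: smooth_rot2.
by apply: smooth_on_vec2 => //; apply: smooth_onM => //; exact: smooth_on_cst.
Qed.

Lemma smooth_density : smooth_on cyl density.
Proof. by apply: smooth_onM => //; exact: smooth_on_cst. Qed.

Lemma derive_material (V : normedModType R) (F h : spacetime -> V) p v : image p ->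
  (forall q, image q -> h q = F (unflow q)) -> smooth_on cyl F ->
  'D_v h p = 'D_(flow_jac_inv (unflow p) v) F (unflow p).
Proof.
move=> Ep hF sF; have [du duE] := diff_unflow v Ep.
have dF := smooth_on_differentiable sF (image_unflow Ep).
have hFp : \forall q \near p, h q = F (unflow q).
  by apply: filterS (open_nbhs_nbhs (conj open_image Ep)).
rewrite (near_eq_derive _ hFp) (derive_comp v du dF).
by rewrite (deriveE v du) duE (deriveE _ dF).
Qed.

(** The direction (u, 1) is the image of (0, 1) under the differential of the
    space-time flow, so unflow pulls it back to (0, 1): the material derivative is
    the time derivative at fixed label. *)
Lemma convective_derivative (V : normedModType R) (F h : spacetime -> V) p :
  image p ->
  (forall q, image q -> h q = F (unflow q)) -> smooth_on cyl F ->
  'D_((0, 1) : spacetime) h p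
  + \sum_(j < 2) velocity (unflow p) j 0
                 *: 'D_((basis_vec R j, 0) : spacetime) h p
  = 'D_((0, 1) : spacetime) F (unflow p).
Proof.
move=> Ep hF sF; have [Du _] := image_unflow Ep.
have [du _] := diff_unflow 0 Ep.
have dF := smooth_on_differentiable sF (image_unflow Ep).
have expand v : 'D_v h p = 'd F (unflow p) ('d unflow p v).
  rewrite (derive_material v Ep hF sF) deriveE//.
  by have [_ ->] := diff_unflow v Ep.
rewrite expand; under eq_bigr do rewrite expand -linearZ -linearZ.
rewrite -linear_sum -linear_sum -linearD -linearD.
rewrite (deriveE _ dF); congr ('d F _ _).
set w : spacetime := _ + _.
(* w = (velocity, 1) is the velocity of the particle in space-time. *)
have -> : w = flow_jac (unflow p) (0, 1).
  rewrite /w !big_ord_recl big_ord0 addr0 /flow_jac /=.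
  congr pair; rewrite /= ?scaler0 ?addr0//.
  rewrite add0r; apply: plane_eqP; rewrite ?vec2_0 ?vec2_1 !mxE /=.
    by rewrite !(mulr1, mulr0, addr0); ring.
  by rewrite !(mulr1, mulr0, addr0, add0r) mulrA.
by have [_ ->] := diff_unflow (flow_jac (unflow p) (0, 1)) Ep; rewrite flow_jacK.
Qed.

Section EulerianFields.
Variables (u : plane -> R -> plane) (r : plane -> R -> R).
Hypothesis u_flow : forall z t, N z ->
  derive1 (fun s => flow (z, s)) t = u (flow (z, t)) t.
Hypothesis r_flow : forall z t, N z -> c0 * z 1 0 = r (flow (z, t)) t.

Lemma eulerian_velocity p : image p -> u p.1 p.2 = velocity (unflow p).
Proof.
move=> Ep; have [Nl pl] := labelP Ep.
rewrite pl -u_flow// derive1_slice_snd.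
have [_ ->] := is_derive_flow (0, 1) (ND Nl : D (unflow p).1).
rewrite /velocity /flow_jac /= !mxE.
by congr vec2; rewrite !(mulr0, add0r, mulr1); ring.
Qed.

Lemma eulerian_density p : image p -> r p.1 p.2 = density (unflow p).
Proof. by move=> Ep; have [Nl pl] := labelP Ep; rewrite pl -r_flow. Qed.

Lemma smooth_eulerian_velocity :
  smooth_on image (fun p : spacetime => u p.1 p.2).
Proof.
apply: (smooth_on_ext open_image (fun p Ep => esym (eulerian_velocity Ep))).
exact: (smooth_on_comp coordinates_spacetime (coordinates_col 2) open_image oC
  image_unflow smooth_unflow smooth_velocity).
Qed.

Lemma smooth_eulerian_density :
  smooth_on image (fun p : spacetime => r p.1 p.2).
Proof.
apply: (smooth_on_ext open_image (fun p Ep => esym (eulerian_density Ep))).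
exact: (smooth_on_comp coordinates_spacetime coordinates_scalar open_image oC
  image_unflow smooth_unflow smooth_density).
Qed.

Lemma eulerian_momentum p : image p ->
  momentum u r p.1 p.2 = vec2 (force1 (unflow p)) (force2 (unflow p)).
Proof.
move=> Ep; rewrite /momentum (derive1_slice_snd (fun q : spacetime => u q.1 q.2)).
under eq_bigr do rewrite (derive_slice_fst (fun q : spacetime => u q.1 q.2)).
rewrite -surjective_pairing eulerian_velocity// eulerian_density//.
rewrite (convective_derivative Ep eulerian_velocity smooth_velocity).
have [Du _] := image_unflow Ep.
have [d1 d2] := is_derive_rot mu sf1 sf2 aCR1 aCR2 (0, 1) Du.
have [_ ->] := is_derive_vec2 (is_deriveZ (- (c * mu)) d2)
                              (is_deriveZ (c^-1 * mu) d1).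
rewrite /force1 /force2 /GRing.scale/= !mxE !mulr0 !mulr1 !addr0 !add0r.
by apply: plane_eqP; rewrite !mxE /=; ring.
Qed.

(** Every derivative along a basis vector e is taken at the label along
    flow_jac_inv q (e, 0), which reduces the divergence and the curl to rational
    expressions in rot1, rot2, rot_diag and rot_off. *)
Lemma euler_boussinesq_image x t : image (x, t) -> euler_boussinesq_at u r x t.
Proof.
move=> Ep; have [Du _] := image_unflow Ep.
set q := unflow (x, t) in Du *.
have dn0 := jac_det_neq0 Du.
have drot v := is_derive_rot mu sf1 sf2 aCR1 aCR2 v Du.
have s1 : smooth_on cyl rot1 by exact: smooth_rot1.
have s2 : smooth_on cyl rot2 by exact: smooth_rot2.
have scale_smooth (a : R) (F : spacetime -> R) : smooth_on cyl F ->
    smooth_on cyl (fun q => a * F q).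
  by move=> sF; apply: smooth_onM => //; exact: smooth_on_cst.
have slice (F h : spacetime -> R) i : (forall p, image p -> h p = F (unflow p)) ->
    smooth_on cyl F ->
    partial i (fun y => h (y, t)) x = 'D_(flow_jac_inv q (basis_vec R i, 0)) F q.
  by move=> hF sF; rewrite /partial derive_slice_fst (derive_material _ Ep hF sF).
have u1E p : image p -> u p.1 p.2 0 0 = - (c * mu) * rot2 (unflow p).
  by move=> Epp; rewrite eulerian_velocity// vec2_0.
have u2E p : image p -> u p.1 p.2 1 0 = c^-1 * mu * rot1 (unflow p).
  by move=> Epp; rewrite eulerian_velocity// vec2_1.
have m1E p : image p -> momentum u r p.1 p.2 0 0 = force1 (unflow p).
  by move=> Epp; rewrite eulerian_momentum// vec2_0.
have m2E p : image p -> momentum u r p.1 p.2 1 0 = force2 (unflow p).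
  by move=> Epp; rewrite eulerian_momentum// vec2_1.
have sforce2 : smooth_on cyl force2.
  by apply: smooth_onD => //; [exact: scale_smooth|exact: smooth_density].
split.
- rewrite /div2 big_ord_recl big_ord1 (_ : lift ord0 ord0 = 1); last exact/val_inj.
  rewrite (slice _ _ 0 u1E (scale_smooth _ _ s2)).
  rewrite (slice _ _ 1 u2E (scale_smooth _ _ s1)).
  have [_ ->] :=
    is_deriveZ (- (c * mu)) (drot (flow_jac_inv q (basis_vec R 0, 0))).2.
  have [_ ->] :=
    is_deriveZ (c^-1 * mu) (drot (flow_jac_inv q (basis_vec R 1, 0))).1.
  rewrite /GRing.scale/= !vec2_0 !vec2_1 !mxE /=.
  move: dn0; rewrite /jac_det.
  by move: (rot1 _) (rot2 _) (rot_diag _) (rot_off _) => *; field; apply/andP.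
- rewrite /curl2 (slice _ _ 0 m2E sforce2) (slice _ _ 1 m1E (scale_smooth _ _ s1)).
  have [_ ->] :=
    is_deriveZ (- (c * mu ^+ 2)) (drot (flow_jac_inv q (basis_vec R 1, 0))).1.
  have [_ ->] := is_deriveD
    (is_deriveZ (- (c^-1 * mu ^+ 2)) (drot (flow_jac_inv q (basis_vec R 0, 0))).2)
    (is_deriveZ c0 (is_derive_coord 1 q (flow_jac_inv q (basis_vec R 0, 0)))).
  rewrite /GRing.scale/= !vec2_0 !vec2_1 !mxE /=.
  (* The curl is proportional to mu^2 (c^4 - 1) - c0 c; eliminating c0 makes it
     vanish identically. *)
  have c0E : c0 = mu ^+ 2 * (c ^+ 4 - 1) / c by rewrite mu_eq mulfK.
  rewrite c0E; move: dn0; rewrite /jac_det.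
  by move: (rot1 _) (rot2 _) (rot_diag _) (rot_off _) => *; field; apply/andP.
- rewrite (derive1_slice_snd (fun q : spacetime => r q.1 q.2)).
  rewrite /partial.
  under eq_bigr do rewrite (derive_slice_fst (fun q : spacetime => r q.1 q.2)).
  rewrite (eulerian_velocity Ep).
  have := convective_derivative Ep eulerian_density smooth_density.
  have [_ ->] := is_deriveZ c0 (is_derive_coord 1 q (0, 1)).
  by rewrite /GRing.scale/= !mxE mulr0.
Qed.

End EulerianFields.
End LabelField.

End StrainedFlow.

(** * Solutions from anti-Cauchy-Riemann pairs *)
Theorem mainTheorem3 (R : realType) (D : set 'cV[R]_2)
    (D_open : open D) (D_connected : connected D) (D_nonempty : D !=set0)
    (c0 c1 mu0 : R)
    (c0_neq0 : c0 != 0) (c1_gt0 : 0 < c1) (c1_neq1 : c1 != 1)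
    (c_pos : 0 < c0 * c1 / (c1 ^+ 4 - 1))
    (mu0E : mu0 ^+ 2 = c0 * c1 / (c1 ^+ 4 - 1))
    (f1 f2 : 'cV[R]_2 -> R)
    (f1_smooth : smooth_on D f1) (f2_smooth : smooth_on D f2)
    (aCR1 : forall z, D z -> partial 0 f1 z + partial 1 f2 z = 0)
    (aCR2 : forall z, D z -> partial 1 f1 z - partial 0 f2 z = 0)
    (nondeg : forall z, D z -> 1 - gradnorm2 f1 z != 0) :
  let phi (z : 'cV[R]_2) (t : R) : 'cV[R]_2 :=
    mx22 c1 0 0 (1 / c1) *m
    (row_mx 1%:M (mx22 (cos (mu0 * t)) (- sin (mu0 * t))
                       (sin (mu0 * t)) (cos (mu0 * t))) *m
     col_mx z (vec2 (f1 z) (f2 z))) in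
  let rho (z : 'cV[R]_2) : R := c0 * z 1 0 in
  (forall z t, D z -> \det (jacmx (phi ^~ t) z) = 1 - gradnorm2 f1 z) /\
  euler_boussinesq_solution D phi rho.
Proof.
move=> phi rho.
have c1_neq0 : c1 != 0 by rewrite gt_eqF.
have c14_neq0 : c1 ^+ 4 - 1 != 0.
  by apply: contraTneq c_pos => ->; rewrite invr0 mulr0 ltxx.
have mu_eq : mu0 ^+ 2 * (c1 ^+ 4 - 1) = c0 * c1 by rewrite mu0E divfK.
have -> : phi = fun z t => flow mu0 c1 f1 f2 (z, t).
  by apply/funext => z; apply/funext => t; exact: flowE.
have detE z t : D z ->
    \det (jacmx ((fun z t => flow mu0 c1 f1 f2 (z, t)) ^~ t) z)
    = 1 - gradnorm2 f1 z.
  by move=> Dz; exact: jacmx_det.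
split=> //; split.
- apply: (smooth_on_ext (f := flow mu0 c1 f1 f2)); first exact: open_cylinder.
    by move=> [].
  exact: smooth_flow.
- move=> k; apply: Ck_onM => //; first exact: Ck_on_cst.
  by apply: (smooth_on_linear (L := @col_coord R 2 1)) => //; exact: coord_continuous.
- by move=> z t Dz; rewrite detE// nondeg.
- by move=> z Dz; exact: flow_locally_injective.
move=> N u r injN u_flow r_flow; split.
- exact: (smooth_eulerian_velocity c1_gt0 D_open f1_smooth f2_smooth aCR1 aCR2
    nondeg injN u_flow).
- exact: (smooth_eulerian_density c1_gt0 D_open f1_smooth f2_smooth aCR1 aCR2
    nondeg injN r_flow).
move=> x t; exact: (euler_boussinesq_image c1_gt0 D_open f1_smooth f2_smooth aCR1
  aCR2 nondeg injN mu_eq u_flow r_flow).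
Qed.
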